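(* Let $\mathfrak{A}$ be a unital, simple, purely infinite C$^*$-algebra with unit $I_{\mathfrak{A}}$ and let $P \in \mathfrak{A}$ be a projection. Then (1) $dist(P, Nil(\mathfrak{A})) = dist(P, QuasiNil(\mathfrak{A})) = 0$ if $P = 0$, (2) $dist(P, Nil(\mathfrak{A})) = dist(P, QuasiNil(\mathfrak{A})) = 1$ if $P = I_{\mathfrak{A}}$, and (3) $dist(P, Nil(\mathfrak{A})) = dist(P, QuasiNil(\mathfrak{A})) = \frac{1}{2}$ otherwise.
   Context: $Nil(\mathfrak{A})$ is the set of nilpotent elements of $\mathfrak{A}$; $QuasiNil(\mathfrak{A})$ is the set of quasinilpotent elements of $\mathfrak{A}$ (those with spectrum $\{0\}$); $dist(P, B) = \inf_{b \in B} \|P - b\|$. A projection is a self-adjoint idempotent. *)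

(* Defs.v *)
From HB Require Import structures.
From mathcomp Require Import all_boot all_order all_algebra.
From mathcomp Require Import complex.
From mathcomp Require Import all_classical all_reals all_analysis.

Set Implicit Arguments.
Unset Strict Implicit.
Unset Printing Implicit Defensive.

Import Order.TTheory GRing.Theory Num.Theory.
Import numFieldNormedType.Exports.

Local Open Scope classical_set_scope.
Local Open Scope ring_scope.

(* The library hierarchy has no join of [GRing.Algebra] with [NormedModule],
   and such a join cannot be added after the fact because [Num.NumDomain] is
   both a ring and a normed Z-module. The ring structure is therefore carried
   by the algebra A itself, and its normed-space structure by the alias
   [normed_of A] defined below. *)
HB.mixin Record Algebra_isNormedAlgebra (R : realType) A
    & GRing.Algebra R[i] A := {
  anorm : A -> R;
  ler_anormD : forall x y, anorm (x + y) <= anorm x + anorm y;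
  anormZ : forall (l : R[i]) x, anorm (l *: x) = complex.Re `|l| * anorm x;
  anorm0_eq0 : forall x, anorm x = 0 -> x = 0;
  ler_anormM : forall x y, anorm (x * y) <= anorm x * anorm y
}.

#[short(type="normedAlgType")]
HB.structure Definition NormedAlgebra (R : realType) :=
  {A of GRing.Algebra R[i] A & Algebra_isNormedAlgebra R A}.

Definition normed_of (R : realType) (A : normedAlgType R) : Type := A.

Section NormedOf.
Variables (R : realType) (A : normedAlgType R).

HB.instance Definition _ := GRing.Lmodule.copy (normed_of A) A.

Let norm (x : normed_of A) : R[i] := real_complex R (anorm (x : A)).

Let ler_normD x y : norm (x + y) <= norm x + norm y.
Proof. by rewrite /norm -rmorphD /= lecR; exact: ler_anormD. Qed.

Let normrZ (l : R[i]) x : norm (l *: x) = `|l| * norm x.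
Proof.
by rewrite /norm (anormZ l (x : A)) rmorphM.
Qed.

Let normr0_eq0 x : norm x = 0 -> x = 0.
Proof. by move=> /eqP; rewrite fmorph_eq0 => /eqP /anorm0_eq0. Qed.

HB.instance Definition _ :=
  Lmodule_isNormed.Build R[i] (normed_of A) ler_normD normrZ normr0_eq0.

End NormedOf.

(* Unital C*-algebras over R[i]; as in any [GRing.Algebra], 1 != 0. *)
HB.mixin Record NormedAlgebra_isCStarAlgebra (R : realType) A
    & NormedAlgebra R A := {
  star : A -> A;
  starK : forall x, star (star x) = x;
  starD : forall x y, star (x + y) = star x + star y;
  starZ : forall (l : R[i]) x, star (l *: x) = l^* *: star x;
  starM : forall x y, star (x * y) = star y * star x;
  cstar_identity : forall x, anorm (star x * x) = anorm x ^+ 2;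
  cstar_complete : forall F : set_system (normed_of A),
    ProperFilter F -> cauchy F -> cvg F
}.

#[short(type="cstarAlgType")]
HB.structure Definition CStarAlgebra (R : realType) :=
  {A of NormedAlgebra R A & NormedAlgebra_isCStarAlgebra R A}.

HB.instance Definition _ (R : realType) (A : cstarAlgType R) :=
  Uniform_isComplete.Build (normed_of A) (@cstar_complete R A).

Section CStarAlgebraDefinitions.
Variables (R : realType) (A : cstarAlgType R).
Implicit Types (x y a b p v : A) (B I : set A).

Definition dist_to x B : R := inf [set anorm (x - b) | b in B].

Definition norm_closed B : Prop := closed (B : set (normed_of A)).

Definition invertible x : Prop := exists y, x * y = 1 /\ y * x = 1.

Definition spectrum x : set R[i] := [set l | ~ invertible (x - l%:A)].

Definition nilpotents : set A := [set x | exists n : nat, x ^+ n = 0].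

Definition quasinilpotents : set A := [set x | spectrum x = [set 0]].

Definition is_projection p : Prop := star p = p /\ p * p = p.

(* In the order of R[i], 0 <= l means that l is real and nonnegative. *)
Definition is_positive a : Prop :=
  star a = a /\ (forall l : R[i], spectrum a l -> 0 <= l).

Definition cstar_le a b : Prop := is_positive (b - a).

(* p is Murray-von Neumann equivalent to the proper subprojection v v^* of p. *)
Definition is_infinite_projection p : Prop :=
  is_projection p /\
  exists v, [/\ star v * v = p, cstar_le (v * star v) p & v * star v <> p].

(* Stability under scalars and opposites is automatic since A has a unit. *)
Definition closed_ideal I : Prop :=
  [/\ norm_closed I, I 0, (forall x y, I x -> I y -> I (x + y))
    & (forall a x, I x -> I (a * x) /\ I (x * a))].

Definition simple_cstar : Prop :=
  forall I, closed_ideal I -> I = [set 0] \/ I = setT.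

(* C*-subalgebras need not contain the unit of A. *)
Definition cstar_subalgebra B : Prop :=
  [/\ norm_closed B, B 0 &
  [/\ (forall x y, B x -> B y -> B (x + y)),
      (forall (l : R[i]) x, B x -> B (l *: x)),
      (forall x y, B x -> B y -> B (x * y))
    & (forall x, B x -> B (star x))]].

Definition hereditary_subalgebra B : Prop :=
  cstar_subalgebra B /\
  forall a b, is_positive a -> cstar_le a b -> B b -> B a.

Definition purely_infinite : Prop :=
  forall B, hereditary_subalgebra B -> B <> [set 0] ->
    exists p, B p /\ is_infinite_projection p.

End CStarAlgebraDefinitions.

Arguments nilpotents {R} A.
Arguments quasinilpotents {R} A.
Arguments simple_cstar {R} A.
Arguments purely_infinite {R} A.

(* Main.v *)
Require Import Defs.
From mathcomp Require Import all_boot all_order all_algebra.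
From mathcomp Require Import complex.
From mathcomp Require Import all_classical all_reals all_analysis.
From mathcomp Require Import ring lra zify.

(** At P = 0 there is nothing to do.  At P = 1, an element at distance less than
    1 from 1 is invertible, while 0 lies in the spectrum of a quasinilpotent;
    the distance 1 is attained at the nilpotent 0.  Nilpotents are
    quasinilpotent, so for the other projections p it suffices to bound the
    distance to all quasinilpotents from below and the distance to the
    nilpotents from above.

    Lower bound ([quasinil_anorm_ge]).  Let q be quasinilpotent with
    |p - q| < 1/2, and put S = 2p - 1, T = 2q - 1, so that S^2 = 1 and
    |S - T| < 1.  Then S T + star(T) S is at least 2 - 2|S - T| > 0, which is a
    Lyapunov inequality: for small h > 0 the element W = 1 + hT satisfies
    S <= star(W) S W, hence S <= star(W^n) S W^n for all n.  The spectrum of W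
    is the single point 1 - h, so W^n becomes small, S <= 1/2, and compressing
    by p gives p = 0.

    Upper bound ([nilpotent_near_projection]).  If p is neither 0 nor 1, the
    algebra contains infinitely many isometries with mutually orthogonal
    ranges below 1 - p ([orthogonal_isometries]), thus arbitrarily many
    orthogonal copies of p below 1 - p.  They provide a system w_k (k < m)
    with star(w_k) w_l = delta_kl p in which p itself is the combination of the
    w_k with coefficients x_k, for any real unit vector x.  Let a_k run over
    the m-th roots of -1, r = 1 / (2 cos (pi/m)), and let D be the sum of the
    r a_k w_k star(w_k), the two roots a_k with largest real part being left
    out.  As D is r times a partial isometry, N = p + D is within r of p, and r
    tends to 1/2 as m grows.  In the coordinates w_k, N is a rank-one
    perturbation of a diagonal matrix, and it is nilpotent exactly when the
    x_k^2 are the residues of -z^(m-2) / prod (z - r a_k); these are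
    the numbers (2 r / m) (cos (pi/m) - Re a_k), positive except at the two
    omitted roots, where they vanish.

    The part of C*-algebra theory that is needed is developed from the norm:
    powers of elements whose spectrum lies in a small disc
    ([spectral_radius_bound]), positivity and square roots ([pos_sqrt],
    [star_mul_pos]). *)

Import Order.TTheory GRing.Theory Num.Theory.
Import numFieldNormedType.Exports.

Local Open Scope ring_scope.

Set Implicit Arguments.
Unset Strict Implicit.
Unset Printing Implicit Defensive.

Local Notation "x %:C" := (real_complex _ x) : ring_scope.

(** * Norm, limits and inverses *)

Section NormAndCompleteness.
Variables (R : realType) (A : cstarAlgType R).
Implicit Types (x y a b : A) (t : R) (l : R[i]).

Lemma starB x y : star (x - y) = star x - star y.
Proof.
by rewrite starD -scaleN1r starZ rmorphN1 scaleN1r.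
Qed.

Lemma star0 : star (0 : A) = 0.
Proof. by rewrite -[X in star X](subrr 0) starB subrr. Qed.

Lemma starN x : star (- x) = - star x.
Proof. by rewrite -sub0r starB star0 sub0r. Qed.

Lemma star1 : star (1 : A) = 1.
Proof. by rewrite -[LHS]mulr1 -{2}(starK 1) -starM mulr1 starK. Qed.

Lemma star_sum I (r : seq I) (Q : pred I) (F : I -> A) :
  star (\sum_(i <- r | Q i) F i) = \sum_(i <- r | Q i) star (F i).
Proof. by elim/big_rec2: _ => [|i y1 y2 _ <-]; rewrite ?star0 // starD. Qed.

Lemma starX x n : star (x ^+ n) = star x ^+ n.
Proof. by elim: n => [|n IH]; rewrite ?expr0 ?star1 // exprS starM IH exprSr. Qed.

Lemma conj_real t : (t%:C : R[i])^* = t%:C.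
Proof. by apply/CrealP; apply/complex_realP; exists t. Qed.

Lemma starZr t x : star (t%:C *: x) = t%:C *: star x.
Proof. by rewrite starZ conj_real. Qed.

Lemma anorm0 : anorm (0 : A) = 0.
Proof. by rewrite -(scale0r (0 : A)) anormZ normr0 mul0r. Qed.

Lemma anormZr t x : anorm (t%:C *: x) = `|t| * anorm x.
Proof.
rewrite anormZ normc_def /= expr0n /= addr0 sqrtr_sqr //.
Qed.

Lemma anormN x : anorm (- x) = anorm x.
Proof. by rewrite -scaleN1r anormZ normrN1 mul1r. Qed.

Lemma anormB x y : anorm (x - y) = anorm (y - x).
Proof. by rewrite -anormN opprB. Qed.

Lemma anorm_ge0 x : 0 <= anorm x.
Proof.
have := ler_anormD x (- x); rewrite subrr anorm0 anormN; lra.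
Qed.

Lemma anorm_le0 x : anorm x <= 0 -> x = 0.
Proof. by move=> h; apply: anorm0_eq0; apply/eqP; rewrite eq_le h anorm_ge0. Qed.

Lemma ler_anormB x y : anorm (x - y) <= anorm x + anorm y.
Proof. by rewrite -(anormN y) ler_anormD. Qed.

Lemma anorm_triangle x y z : anorm (x - z) <= anorm (x - y) + anorm (y - z).
Proof. by rewrite -[x - z](subrKA y) ler_anormD. Qed.

Lemma anorm1 : anorm (1 : A) = 1.
Proof.
have h := cstar_identity (1 : A); rewrite star1 mulr1 in h.
have n0 : anorm (1 : A) != 0.
  by apply: contraNneq (oner_neq0 A) => /anorm0_eq0 ->.
by apply: (mulfI n0); rewrite mulr1 -expr2 -h.
Qed.

Lemma anorm_star x : anorm (star x) = anorm x.
Proof.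
suff le y : anorm y <= anorm (star y).
  by apply/eqP; rewrite eq_le le -{2}(starK x) le.
have [->|n0] := eqVneq (anorm y) 0; first exact: anorm_ge0.
have p : 0 < anorm y by rewrite lt_def n0 anorm_ge0.
by rewrite -(ler_pM2r p) -expr2 -cstar_identity ler_anormM.
Qed.

Lemma anorm_alg t : anorm (t%:C%:A : A) = `|t|.
Proof. by rewrite anormZr anorm1 mulr1. Qed.

Lemma ler_anormX x n : anorm (x ^+ n) <= anorm x ^+ n.
Proof.
elim: n => [|n IH]; first by rewrite !expr0 anorm1.
by rewrite !exprS; apply: le_trans (ler_anormM _ _) (ler_wpM2l (anorm_ge0 _) IH).
Qed.

Lemma star_mul_eq0 x : star x * x = 0 -> x = 0.
Proof.
move=> h; apply: anorm0_eq0; have := cstar_identity x.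
by rewrite h anorm0 => /esym/eqP; rewrite expf_eq0 /= => /eqP.
Qed.

Definition acvg (a : nat -> A) (lim : A) : Prop :=
  forall eps : R, 0 < eps -> exists N : nat, forall n, (N <= n)%N ->
    anorm (a n - lim) < eps.

Lemma normed_ofE (x y : A) : `|(x : normed_of A) - y| = (anorm (x - y))%:C.
Proof. by []. Qed.

(** The norm of [normed_of A] takes values in R[i]; this is the bridge from its
    topology to estimates with the real-valued [anorm]. *)
Lemma nbhs_anormP (x : A) (U : set A) :
  nbhs (x : normed_of A) U <->
  exists2 e : R, 0 < e & forall y : A, anorm (x - y) < e -> U y.
Proof.
split.
  move=> /nbhs_ballP [e /= e0 he].
  have er : e \is Num.real by exact: gtr0_real.
  exists (complex.Re e).
    by move: e0; rewrite ltcE /= => /andP[].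
  move=> y hy; apply: he; rewrite -ball_normE /= normed_ofE.
  by rewrite -(RRe_real er) ltcR.
move=> [e e0 he]; apply/nbhs_ballP; exists e%:C => /=; first by rewrite ltcR.
by move=> y; rewrite -ball_normE /= normed_ofE ltcR; exact: he.
Qed.

Lemma norm_closedP (B : set A) :
  norm_closed B <->
  forall x, (forall e : R, 0 < e -> exists2 b, B b & anorm (x - b) < e) -> B x.
Proof.
rewrite /norm_closed closedE.
split.
  move=> hB x hx; apply: hB => hn.
  have /nbhs_anormP [e e0 he] := hn.
  by have [b Bb /he] := hx e e0.
move=> hB x hx; apply: hB => e e0.
apply: contrapT => hn; apply: hx; apply/nbhs_anormP; exists e => // y hy By.
by apply: hn; exists y.
Qed.

(** Closures are used in this metric form, which makes membership an
    approximation statement. *)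
Lemma norm_closed_closure (B : set A) :
  norm_closed [set x | forall e : R, 0 < e -> exists2 b, B b & anorm (x - b) < e].
Proof.
apply/norm_closedP => x hx e e0 /=.
have [|y hy xy] := hx (e / 2); first by lra.
have [|b Bb yb] := hy (e / 2); first by lra.
exists b => //; have := anorm_triangle x y b; lra.
Qed.

(** All limits below come from sequences whose increments are dominated by those
    of a bounded real sequence: geometric sums for inverses, and the scalar
    iteration of the square root. *)
Lemma acvg_dominated (a : nat -> A) (g : nat -> R) (M : R) :
  (forall m n, (n <= m)%N -> anorm (a m - a n) <= g m - g n) ->
  (forall n, g n <= M) -> exists lim, acvg a lim.
Proof.
move=> ha hM.
have gi m n : (n <= m)%N -> g n <= g m.
  by move=> /ha h; rewrite -subr_ge0; apply: le_trans h; exact: anorm_ge0.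
have hs : has_sup [set g n | n in setT].
  by split; [exists (g 0%N), 0%N | exists M => _ [n _ <-]].
pose s := sup [set g n | n in setT].
have gs n : g n <= s by apply: ub_le_sup; [case: hs | exists n].
have small e : 0 < e -> exists N, forall n, (N <= n)%N -> s - g n < e.
  move=> e0; have [_ [N _ <-] hN] := sup_adherent e0 hs.
  by exists N => n /gi hn; rewrite -/s in hN; lra.
pose F : set_system (normed_of A) := ((a : nat -> normed_of A) @ \oo)%classic.
have cF : cauchy F.
  apply/cauchy_ballP => e e0.
  have er : e \is Num.real by exact: gtr0_real.
  have e0' : 0 < complex.Re e by move: e0; rewrite ltcE /= => /andP[].
  have [|N hN] := small (complex.Re e / 2); first by lra.
  exists ([set x | anorm (x - a N) < complex.Re e / 2],
          [set x | anorm (x - a N) < complex.Re e / 2])%classic => /=.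
    have fN : F [set x | anorm ((x : A) - a N) < complex.Re e / 2]%classic.
      exists N => //= n Nn; apply: le_lt_trans (ha _ _ Nn) _.
      by have := hN N (leqnn N); have := gs n; lra.
    by split.
  move=> [x y] /= [hx hy]; rewrite -ball_normE /= normed_ofE -(RRe_real er) ltcR.
  by have := anorm_triangle x (a N) y; rewrite (anormB (a N)); lra.
pose l := [lim F in normed_of A]%classic; have hl : (F --> l)%classic := @cstar_complete R A F _ cF.
exists l => e e0.
have : nbhs (l : normed_of A) [set x | anorm ((x : A) - l) < e]%classic.
  by apply/nbhs_anormP; exists e => // y; rewrite anormB.
by move=> /hl [N _ hN]; exists N => n; exact: hN.
Qed.

Lemma acvg_unique a b (u : nat -> A) : acvg u a -> acvg u b -> a = b.
Proof.
move=> ha hb; apply/eqP; rewrite -subr_eq0; apply/eqP; apply: anorm_le0.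
rewrite leNgt; apply/negP => h.
have [|N1 h1] := ha (anorm (a - b) / 2); first by lra.
have [|N2 h2] := hb (anorm (a - b) / 2); first by lra.
have := h1 (maxn N1 N2) (leq_maxl _ _); have := h2 (maxn N1 N2) (leq_maxr _ _).
have := anorm_triangle a (u (maxn N1 N2)) b; rewrite (anormB a (u _)); lra.
Qed.

Lemma acvg_lipschitz (f : A -> A) (K : R) (u : nat -> A) a :
  (forall x, anorm (f x - f a) <= K * anorm (x - a)) ->
  acvg u a -> acvg (f \o u) (f a).
Proof.
move=> hf hu e e0.
have K1 : 0 < `|K| + 1 by apply: ltr_wpDl.
have [|N hN] := hu (e / (`|K| + 1)); first exact: divr_gt0.
exists N => n /hN; rewrite ltr_pdivlMr //=; apply: le_lt_trans.
apply: le_trans (hf _) _; rewrite mulrC; apply: ler_wpM2l; first exact: anorm_ge0.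
by have := ler_norm K; lra.
Qed.

Lemma acvg_mull x u a : acvg u a -> acvg (fun n => x * u n) (x * a).
Proof.
apply: (@acvg_lipschitz (fun y => x * y) (anorm x)) => y.
by rewrite -mulrBr ler_anormM.
Qed.

Lemma acvg_mulr x u a : acvg u a -> acvg (fun n => u n * x) (a * x).
Proof.
apply: (@acvg_lipschitz (fun y => y * x) (anorm x)) => y.
by rewrite -mulrBl mulrC ler_anormM.
Qed.

Lemma acvg_star u a : acvg u a -> acvg (fun n => star (u n)) (star a).
Proof.
apply: (@acvg_lipschitz (@star R A) 1) => y.
by rewrite -starB anorm_star mul1r.
Qed.

Lemma acvg_shift u a : acvg u a -> acvg (fun n => u n.+1) a.
Proof. by move=> h e /h [N hN]; exists N => n Nn; apply/hN/leqW. Qed.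

Lemma acvg_anorm_le u a (c : R) : (forall n, anorm (u n) <= c) -> acvg u a -> anorm a <= c.
Proof.
move=> hc hu; rewrite leNgt; apply/negP => h.
have [|N /(_ N (leqnn N)) hN] := hu (anorm a - c); first by lra.
have := hc N; have := ler_anormD (a - u N) (u N); rewrite subrK (anormB a); lra.
Qed.

Lemma invertibleP x y z : x * y = 1 -> z * x = 1 -> invertible x.
Proof.
move=> xy zx; exists y; split=> //.
by have -> : y = z by rewrite -[y]mul1r -zx -mulrA xy mulr1.
Qed.

Lemma invertible1 : invertible (1 : A).
Proof. by exists 1; rewrite mulr1. Qed.

Lemma invertibleM x y : invertible x -> invertible y -> invertible (x * y).
Proof.
move=> [x' [xx' x'x]] [y' [yy' y'y]]; exists (y' * x'); split.
  by rewrite mulrA -(mulrA x) yy' mulr1.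
by rewrite mulrA -(mulrA y') x'x mulr1.
Qed.

Lemma invertibleZ l x : l != 0 -> invertible x -> invertible (l *: x).
Proof.
move=> l0 [y [xy yx]]; exists (l^-1 *: y).
by rewrite -!scalerAl -!scalerAr !scalerA mulfV ?mulVf // !scale1r.
Qed.

Lemma invertibleZP l x : l != 0 -> invertible (l *: x) <-> invertible x.
Proof.
move=> l0; split; last exact: invertibleZ.
move=> h; have := invertibleZ (invr_neq0 l0) h.
by rewrite scalerA mulVf // scale1r.
Qed.

Lemma invertibleN x : invertible (- x) <-> invertible x.
Proof. by rewrite -scaleN1r; apply: invertibleZP; rewrite oppr_eq0 oner_eq0. Qed.

Lemma invertible_comm_mul x y : x * y = y * x -> invertible (x * y) -> invertible x.
Proof.
move=> c [z [h1 h2]]; apply: (@invertibleP x (y * z) (z * y)).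
  by rewrite mulrA.
by rewrite -mulrA -c.
Qed.

Lemma expr_eventually_lt (r e : R) : 0 <= r -> r < 1 -> 0 < e ->
  exists N, forall n, (N <= n)%N -> r ^+ n < e.
Proof.
move=> r0 r1 e0.
have /(@cvg_expr R) : `|r| < 1 by rewrite ger0_norm.
move=> /cvgrPdist_lt /(_ e e0) [N _ hN]; exists N => n /hN /=.
by rewrite sub0r normrN ger0_norm // exprn_ge0.
Qed.

Lemma acvg_expr x : anorm x < 1 -> acvg (fun n => x ^+ n) 0.
Proof.
move=> x1 e e0; have [N hN] := expr_eventually_lt (anorm_ge0 x) x1 e0.
by exists N => n /hN; rewrite subr0; apply: le_lt_trans; exact: ler_anormX.
Qed.

(** The inverse is the sum of the geometric series of x, whose partial sums are
    dominated by those of the norm of x. *)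
Lemma neumann x : anorm x < 1 ->
  exists b, [/\ (1 - x) * b = 1, b * (1 - x) = 1 & anorm b <= (1 - anorm x)^-1].
Proof.
set r := anorm x => r1.
have r0 : 0 <= r by exact: anorm_ge0.
have d0 : 0 < 1 - r by lra.
pose u n := \sum_(i < n) x ^+ i.
pose g n := \sum_(i < n) r ^+ i.
have gM n : g n <= (1 - r)^-1.
  rewrite -[leRHS]mul1r ler_pdivlMr // mulrC -opprB mulNr -subrX1 opprB.
  by rewrite gerBl exprn_ge0.
have ug m n : (n <= m)%N -> anorm (u m - u n) <= g m - g n.
  move=> /subnKC <-; elim: (m - n)%N => [|k IH].
    by rewrite addn0 !subrr anorm0.
  rewrite addnS /u /g !big_ord_recr /= -/(u _) -/(g _) (addrAC (u _)) (addrAC (g _)).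
  by apply: le_trans (ler_anormD _ _) _; apply: lerD IH _; exact: ler_anormX.
have [b hb] := acvg_dominated ug gM.
have lim1 : acvg (fun n => 1 - x ^+ n) 1.
  move=> e /(acvg_expr r1) [N hN]; exists N => n /hN.
  by rewrite subr0 addrAC subrr sub0r anormN.
exists b; split.
- apply: (acvg_unique (acvg_mull (1 - x) hb)).
  move=> e /lim1 [N hN]; exists N => n /hN.
  by rewrite -[1 - x ^+ n]opprB subrX1 -mulNr opprB.
- apply: (acvg_unique (acvg_mulr (1 - x) hb)).
  move=> e /lim1 [N hN]; exists N => n /hN.
  suff -> : u n * (1 - x) = 1 - x ^+ n by [].
  rewrite -[RHS]opprB subrX1 -mulNr opprB; apply: commr_sym; apply: commr_sum => i _.
  apply: commrX; apply: commr_sym; apply: commrB; [exact: commr1|exact: commr_refl].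
- apply: acvg_anorm_le hb => n; apply: le_trans (gM n).
  by have := ug n 0%N (leq0n n); rewrite /u /g !big_ord0 !subr0.
Qed.

Lemma invertible_near1 x : anorm (1 - x) < 1 -> invertible x.
Proof. by move=> /neumann [b []]; rewrite opprB addrC subrK => h1 h2 _; exists b. Qed.

Lemma invertible_gt_anorm x l : anorm x < complex.Re `|l| -> invertible (x - l%:A).
Proof.
move=> h.
have l0 : l != 0.
  by apply: contraTneq h => ->; rewrite normr0 -leNgt anorm_ge0.
have -> : x - l%:A = (- l) *: (1 - l^-1 *: x).
  by rewrite scalerBr scalerA mulNr mulfV // scaleN1r opprK addrC scaleNr.
apply: invertibleZ; first by rewrite oppr_eq0.
apply: invertible_near1; rewrite opprB addrC subrK anormZ normfV.
have p : 0 < complex.Re `|l| by apply: le_lt_trans h; exact: anorm_ge0.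
have -> : complex.Re (`|l|^-1) = (complex.Re `|l|)^-1.
  by rewrite normc_def -fmorphV.
by rewrite mulrC ltr_pdivrMr // mul1r.
Qed.

(** Inversion is locally bounded: y = x (1 - b (x - y)) and the Neumann
    series of the second factor is bounded by 2. *)
Lemma inverse_perturb x y b (M : R) : x * b = 1 -> b * x = 1 -> anorm b <= M ->
  M * anorm (x - y) <= 1 / 2 ->
  exists b', [/\ y * b' = 1, b' * y = 1 & anorm b' <= 2 * M].
Proof.
move=> xb bx bM h.
have h1 : anorm (b * (x - y)) <= 1 / 2.
  apply: le_trans (ler_anormM _ _) (le_trans _ h).
  by apply: ler_wpM2r => //; exact: anorm_ge0.
have h2 : anorm ((x - y) * b) <= 1 / 2.
  apply: le_trans (ler_anormM _ _) (le_trans _ h).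
  by rewrite mulrC; apply: ler_wpM2r => //; exact: anorm_ge0.
have [|c [c1 c2 cn]] := @neumann (b * (x - y)); first by lra.
have [|d [d1 d2 _]] := @neumann ((x - y) * b); first by lra.
have yE : y = x * (1 - b * (x - y)).
  by rewrite mulrBr mulr1 mulrA xb mul1r opprB addrC subrK.
have yE' : y = (1 - (x - y) * b) * x.
  by rewrite mulrBl mul1r -mulrA bx mulr1 opprB addrC subrK.
have y1 : y * (c * b) = 1.
  by rewrite {1}yE mulrA -(mulrA x) c1 mulr1.
have y2 : (c * b) * y = 1.
  by rewrite {1}yE mulrA -(mulrA c) bx mulr1 c2.
exists (c * b); split => //; apply: le_trans (ler_anormM _ _) _.
apply: ler_pM => //; try exact: anorm_ge0.
apply: le_trans cn _.
rewrite -[leRHS]invrK lef_pV2 ?posrE ?invr_gt0 //; lra.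
Qed.
End NormAndCompleteness.

(** * Powers and the spectrum *)

Section SpectralRadius.
Variables (R : realType) (A : cstarAlgType R).
Implicit Types (x y a b : A) (t : R) (l mu : R[i]).

(** A total inverse, so that resolvents are functions of their parameter. *)
Definition ainv x : A := xget 0 [set y | x * y = 1 /\ y * x = 1]%classic.

Lemma ainvP x : invertible x -> x * ainv x = 1 /\ ainv x * x = 1.
Proof. by move=> h; exact: (xgetPex 0 h). Qed.

Lemma ainv_eq x b : x * b = 1 -> b * x = 1 -> ainv x = b.
Proof.
move=> xb bx; have [h1 h2] : x * ainv x = 1 /\ ainv x * x = 1.
  by apply: ainvP; exists b.
by rewrite -[ainv x]mulr1 -xb mulrA h2 mul1r.
Qed.

Definition cabs l : R := complex.Re `|l|.

Lemma cabsE l : (cabs l)%:C = `|l|.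
Proof. by rewrite /cabs RRe_real // normr_real. Qed.

Lemma cabs_ge0 l : 0 <= cabs l.
Proof. by rewrite -lecR cabsE normr_ge0. Qed.

Lemma cabsM l mu : cabs (l * mu) = cabs l * cabs mu.
Proof. by apply: complexI; rewrite rmorphM /= !cabsE normrM. Qed.

Lemma cabsV l : cabs l^-1 = (cabs l)^-1.
Proof. by apply: complexI; rewrite fmorphV /= !cabsE normfV. Qed.

Lemma cabs_eq0 l : (cabs l == 0) = (l == 0).
Proof. by rewrite -(inj_eq (@complexI R)) cabsE normr_eq0. Qed.

Lemma cabsR t : cabs t%:C = `|t|.
Proof. by rewrite /cabs normc_def /= expr0n /= addr0 sqrtr_sqr. Qed.

Lemma cabsD l mu : cabs (l + mu) <= cabs l + cabs mu.
Proof. by rewrite -lecR rmorphD /= !cabsE ler_normD. Qed.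

Lemma cabsN l : cabs (- l) = cabs l.
Proof. by rewrite /cabs normrN. Qed.

Lemma cabs_i : cabs 'i%C = 1 :> R.
Proof. by rewrite /cabs normc_def /= expr0n expr1n /= add0r sqrtr1. Qed.

(** Resolvents are locally bounded ([inverse_perturb]) and the closed unit disc
    is covered by the compact square with vertices 1 + i, 1 - i, -1 + i, -1 - i.
    Points of the square outside the disc have a neighbourhood outside the
    disc, where there is nothing to bound. *)
Lemma resolvent_bounded y :
  (forall mu, cabs mu <= 1 -> invertible (1 - mu *: y)) ->
  exists M : R, forall mu, cabs mu <= 1 -> anorm (ainv (1 - mu *: y)) <= M.
Proof.
move=> hinv.
pose P (M : R) (z : R * R) := cabs (z.1 +i* z.2)%C <= 1 ->
  anorm (ainv (1 - (z.1 +i* z.2)%C *: y)) <= M.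
pose K := (`[(-1 : R), 1] `*` `[(-1 : R), 1])%classic.
have cK : compact K by apply: compact_setX; exact: segment_compact.
have near_dist (z : R * R) (e : R) : 0 < e ->
    nbhs z [set w | cabs ((w.1 +i* w.2)%C - (z.1 +i* z.2)%C) < e]%classic.
  move=> e0; exists (ball z.1 (e / 2), ball z.2 (e / 2)) => /=.
    by split; apply: nbhsx_ballx; lra.
  move=> [u v] /=; rewrite -!ball_normE /= => -[h1 h2].
  have -> : (u +i* v)%C - (z.1 +i* z.2)%C = (u - z.1)%:C + 'i%C * (v - z.2)%:C.
    by rewrite [LHS]complexE.
  apply: le_lt_trans (cabsD _ _) _; rewrite cabsM cabs_i mul1r !cabsR.
  by rewrite (distrC u) (distrC v); lra.
have hP z : K z -> (\forall w \near z & M \near +oo, P M w)%classic.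
  move=> _; have [z1|z1] := leP (cabs (z.1 +i* z.2)%C) 1.
    have [xb bx] := ainvP (hinv _ z1).
    set b := ainv _ in xb bx.
    pose d := (2 * (anorm b + 1) * (anorm y + 1))^-1.
    have d0 : 0 < d.
      by rewrite invr_gt0 !mulr_gt0 // ltr_wpDl // anorm_ge0.
    exists ([set w | cabs ((w.1 +i* w.2)%C - (z.1 +i* z.2)%C) < d],
            [set M | 2 * anorm b <= M])%classic => /=.
      by split; [exact: near_dist|apply: nbhs_pinfty_ge; exact: num_real].
    move=> [w M] /= [hw hM] _.
    have [|b' [h1 h2 h3]] := inverse_perturb (y := 1 - (w.1 +i* w.2)%C *: y) xb bx (lexx _).
      rewrite opprB addrCA addrAC subrr add0r -scalerBl anormZ -/(cabs _).
      have := anorm_ge0 b; have := anorm_ge0 y.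
      move: (anorm b) (anorm y) @d d0 hw => p q d d0 hw q0 p0.
      have dE : d * (2 * (p + 1) * (q + 1)) = 1.
        by apply: mulVf; rewrite !mulf_neq0 //; lra.
      have c0 := cabs_ge0 ((w.1 +i* w.2)%C - (z.1 +i* z.2)%C).
      clearbody d; move: (cabs _) hw c0 => c hw c0.
      have : p * (c * q) <= (p + 1) * (d * (q + 1)).
        by apply: ler_pM; [|apply: mulr_ge0|lra|apply: ler_pM; lra].
      have -> : (p + 1) * (d * (q + 1)) = 1 / 2 by lra.
      by [].
    by rewrite (ainv_eq h1 h2); apply: le_trans h3 hM.
  exists ([set w | cabs ((w.1 +i* w.2)%C - (z.1 +i* z.2)%C) < cabs (z.1 +i* z.2)%C - 1],
          setT)%classic => /=.
    by split; [apply: near_dist; lra|exact: filterT].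
  move=> [w M] /= [hw _] h.
  have := cabsD (w.1 +i* w.2)%C (- ((w.1 +i* w.2)%C - (z.1 +i* z.2)%C)).
  by rewrite cabsN opprB addrC subrK => ?; lra.
have := (compact_near_coveringP _).1 cK _ (pinfty_nbhs R) P _ hP.
move=> /(_ ltac:(typeclasses eauto)) /filter_ex [M hM]; exists M => mu mu1.
have [re im] : `|complex.Re mu| <= 1 /\ `|complex.Im mu| <= 1.
  have : complex.Re mu ^+ 2 + complex.Im mu ^+ 2 <= 1.
    rewrite -lecR add_Re2_Im2 -cabsE -rmorphXn /= lecR.
    by rewrite exprn_ile1 // cabs_ge0.
  have := sqr_ge0 (complex.Re mu); have := sqr_ge0 (complex.Im mu) => i0 r0 s1.
  by split; rewrite -ler_sqr ?nnegrE // expr1n real_normK ?num_real //; lra.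
have := hM (complex.Re mu, complex.Im mu); rewrite /P /=.
have -> : (complex.Re mu +i* complex.Im mu)%C = mu by case: (mu).
by apply => //; split; rewrite /= in_itv /= -ler_norml.
Qed.

Lemma root_of_neg1 k : exists eta : R[i], eta ^+ (2 ^ k) = -1 /\ cabs eta = 1.
Proof.
suff [eta h] : exists eta : R[i], eta ^+ (2 ^ k) = -1.
  exists eta; split=> //; apply: complexI; rewrite cabsE.
  apply/eqP; rewrite -(@pexpr_eq1 _ _ (2 ^ k)) ?expn_gt0 //.
  by rewrite -normrX h normrN1.
elim: k => [|k [eta h]]; first by exists (-1); rewrite expr1.
by exists (sqrtC eta); rewrite expnS exprM sqrtCK.
Qed.

Section PowerBounded.
Variable y : A.
Hypothesis hinv : forall mu, cabs mu <= 1 -> invertible (1 - mu *: y).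

Let F k mu : A := ainv (1 - (mu *: y) ^+ (2 ^ k)).

Let F_step k mu eta : eta ^+ (2 ^ k) = -1 ->
  invertible (1 - (mu *: y) ^+ (2 ^ k)) ->
  invertible (1 - ((eta * mu) *: y) ^+ (2 ^ k)) ->
  invertible (1 - (mu *: y) ^+ (2 ^ k.+1)) /\
  F k.+1 mu = (1 / 2)%:C *: (F k mu + F k (eta * mu)).
Proof.
move=> he; rewrite /F -scalerA (exprZn eta) he scaleN1r opprK expnSr exprM.
set z := (mu *: y) ^+ _ => /ainvP [b1 b2] /ainvP [c1 c2].
set b := ainv _ in b1 b2 *; set c := ainv (1 + z) in c1 c2 *.
have two : (1 / 2)%:C *: (1 + 1 : A) = 1.
  rewrite scalerDr -scalerDl -rmorphD /= (_ : 1 / 2 + 1 / 2 = 1 :> R) ?scale1r //.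
  by lra.
have z1 : 1 - z ^+ 2 = (1 + z) * (1 - z).
  by rewrite mulrDl mul1r mulrBr mulr1 addrA subrK expr2.
have z2 : 1 - z ^+ 2 = (1 - z) * (1 + z).
  by rewrite mulrBl mul1r mulrDr mulr1 opprD addrA addrK expr2.
have h1 : (1 - z ^+ 2) * ((1 / 2)%:C *: (b + c)) = 1.
  rewrite -scalerAr mulrDr {1}z1 z2 -!mulrA b1 c1.
  by rewrite !mulr1 addrACA subrr addr0 two.
have h2 : ((1 / 2)%:C *: (b + c)) * (1 - z ^+ 2) = 1.
  rewrite -scalerAl mulrDl {1}z2 z1 !mulrA b2 c2.
  by rewrite (mul1r (1 + z)) (mul1r (1 - z)) addrACA subrr addr0 two.
by split; [exists ((1 / 2)%:C *: (b + c)) | exact: ainv_eq].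
Qed.

Let half_norm a b (e : R) : anorm a <= e -> anorm b <= e ->
  anorm ((1 / 2)%:C *: (a + b)) <= e.
Proof.
move=> ha hb; rewrite anormZr ger0_norm; last lra.
by have := ler_anormD a b; lra.
Qed.

(** With eta a 2^k-th root of -1, the partial fraction identity
    1 / (1 - z^2) = (1 / (1 - z) + 1 / (1 + z)) / 2 for z = (mu y)^(2^k) writes
    the resolvent for exponent 2^(k+1) as the mean of those for 2^k at mu and
    eta mu.  Means preserve the bound M and the Lipschitz constant along rays,
    so both are uniform in k.  This averaging replaces the Cauchy integral
    formula in the spectral radius theorem. *)
Lemma dyadic_resolvent (M : R) :
  (forall mu, cabs mu <= 1 -> anorm (ainv (1 - mu *: y)) <= M) ->
  forall k mu, cabs mu <= 1 ->
  [/\ invertible (1 - (mu *: y) ^+ (2 ^ k)),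
      anorm (F k mu) <= M &
      forall s t, 0 <= s <= 1 -> 0 <= t <= 1 ->
        anorm (F k (s%:C * mu) - F k (t%:C * mu)) <= M ^+ 2 * anorm y * `|s - t| ].
Proof.
move=> hM; elim=> [|k IH] mu mu1.
  rewrite /F expr1; split; [exact: hinv|exact: hM|].
  have sc s : 0 <= s <= 1 -> cabs (s%:C * mu) <= 1.
    move=> /andP[s0 s1]; rewrite cabsM cabsR ger0_norm // mulr_ile1 //.
    exact: cabs_ge0.
  move=> s t /sc s1 /sc t1; rewrite !expr1.
  have [b1 b2] := ainvP (hinv s1); have [c1 c2] := ainvP (hinv t1).
  have bM := hM _ s1; have cM := hM _ t1.
  set b := ainv _ in b1 b2 bM *; set c := ainv (1 - _ *: y) in c1 c2 cM *.
  have -> : b - c = b * (((s - t)%:C * mu) *: y) * c.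
    have -> : ((s - t)%:C * mu) *: y = (1 - (t%:C * mu) *: y) - (1 - (s%:C * mu) *: y).
      by rewrite opprB addrCA addrAC subrr add0r -scalerBl -mulrBl -rmorphB.
    by rewrite mulrBr mulrBl b2 mul1r -mulrA c1 mulr1.
  apply: le_trans (ler_anormM _ _) _.
  have M0 : 0 <= M by apply: le_trans bM; exact: anorm_ge0.
  have -> : M ^+ 2 * anorm y * `|s - t| = M * (`|s - t| * anorm y) * M by ring.
  apply: ler_pM => //; try exact: anorm_ge0.
  apply: le_trans (ler_anormM _ _) _.
  apply: ler_pM => //; try exact: anorm_ge0.
  rewrite anormZ -/(cabs _) cabsM cabsR; apply: ler_wpM2r; first exact: anorm_ge0.
  by rewrite ler_piMr.
have [eta [he e1]] := root_of_neg1 k.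
have em nu : cabs nu <= 1 -> cabs (eta * nu) <= 1 by rewrite cabsM e1 mul1r.
have step nu : cabs nu <= 1 -> invertible (1 - (nu *: y) ^+ (2 ^ k.+1)) /\
    F k.+1 nu = (1 / 2)%:C *: (F k nu + F k (eta * nu)).
  by move=> nu1; apply: F_step => //; [case: (IH nu nu1)|case: (IH _ (em _ nu1))].
have [i1 F1] := step mu mu1.
have [_ n1 l1] := IH mu mu1; have [_ n2 l2] := IH _ (em _ mu1).
split=> //; first by rewrite F1; apply: half_norm.
move=> s t hs ht.
have sc u : 0 <= u <= 1 -> cabs (u%:C * mu) <= 1.
  move=> /andP[u0 u1]; rewrite cabsM cabsR ger0_norm // mulr_ile1 //.
  exact: cabs_ge0.
rewrite (step _ (sc _ hs)).2 (step _ (sc _ ht)).2 -scalerBr opprD addrACA.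
by apply: half_norm; [exact: l1|rewrite !(mulrCA eta); exact: l2].
Qed.

Let Z (r : R) := forall e : R, 0 < e ->
  exists N, forall k, (N <= k)%N -> anorm ((r%:C *: y) ^+ (2 ^ k)) < e.
Let B (r : R) :=
  exists N, forall k, (N <= k)%N -> anorm ((r%:C *: y) ^+ (2 ^ k)) <= 3.

Let Z_of_B r s : 0 <= r < s -> B s -> Z r.
Proof.
move=> /andP[r0 rs] [N hN] e e0.
have s0 : 0 < s by apply: le_lt_trans rs.
have q0 : 0 <= r / s by apply: divr_ge0 => //; exact: ltW.
have q1 : r / s < 1 by rewrite ltr_pdivrMr // mul1r.
have [|N' hN'] := expr_eventually_lt q0 q1 (_ : 0 < e / 3); first by lra.
exists (maxn N N') => k; rewrite geq_max => /andP[/hN h1 /leq_trans h2].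
have -> : r%:C *: y = (r / s)%:C *: (s%:C *: y).
  by rewrite scalerA -rmorphM /= mulfVK // gt_eqF.
rewrite exprZn -rmorphXn /= anormZr ger0_norm ?exprn_ge0 //.
have /hN' h3 := h2 _ (ltnW (ltn_expl k (isT : (1 < 2)%N))).
have p0 : 0 <= (r / s) ^+ (2 ^ k) by exact: exprn_ge0.
apply: le_lt_trans (ler_wpM2l p0 h1) _; lra.
Qed.

(** Start at r = 0, where the powers of r y tend to 0, and increase r.  If
    (r y)^(2^k) tends to 0, its resolvents tend to 1; by the uniform Lipschitz
    bound those of s y stay close to 1 for s slightly larger than r, which
    bounds (s y)^(2^k); below s the powers then tend to 0 again.  Finitely many
    steps of fixed length reach r = 1. *)
Lemma dyadic_powers_bounded :
  exists N, forall k, (N <= k)%N -> anorm (y ^+ (2 ^ k)) <= 3.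
Proof.
suff [N hN] : B 1 by exists N => k /hN; rewrite scale1r.
have [M hM] := resolvent_bounded hinv.
have dr := dyadic_resolvent hM.
set L := M ^+ 2 * anorm y in dr.
have L0 : 0 <= L by rewrite mulr_ge0 ?anorm_ge0 // sqr_ge0.
have B_of_Z r s : 0 <= r -> r <= s -> s <= 1 -> L * (s - r) <= 1 / 4 -> Z r -> B s.
  move=> r0 rs s1 hL /(_ (1 / 8)) [|N hN]; first lra.
  exists N => k /hN hk.
  have c1 : cabs 1 <= 1 :> R by rewrite /cabs normr1.
  have [_ _ lip] := dr k 1 c1.
  have := lip s r; rewrite !mulr1 (ger0_norm (_ : 0 <= s - r)); last lra.
  move=> /(_ _ _) h; have {h} hl : anorm (F k s%:C - F k r%:C) <= 1 / 4.
    by apply: le_trans (h _ _) hL; lra.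
  have cs : cabs s%:C <= 1 by rewrite cabsR ger0_norm //; lra.
  have [is_ _ _] := dr k s%:C cs.
  move: hl; rewrite /F; set x := (r%:C *: y) ^+ _ in hk *.
  set w := (s%:C *: y) ^+ _ in is_ *.
  have [|b [b1 b2 bn]] := @neumann _ _ x; first lra.
  rewrite (ainv_eq b1 b2).
  have [g1 g2] := ainvP is_; set G := ainv _ in g1 g2 * => hl.
  have bn2 : anorm b <= 8 / 7.
    apply: le_trans bn _; rewrite -[leRHS]invrK lef_pV2 ?posrE ?invr_gt0; lra.
  have hb : anorm (b - 1) <= 1 / 7.
    have -> : b - 1 = x * b by rewrite -b1 mulrBl mul1r opprB addrC subrK.
    apply: le_trans (ler_anormM _ _) _.
    have : anorm x * anorm b <= 1 / 8 * (8 / 7).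
      by apply: ler_pM; rewrite ?anorm_ge0 // ltW.
    lra.
  have hG : anorm (1 - G) <= 1 / 2.
    have := anorm_triangle 1 b G; rewrite (anormB 1 b) (anormB b G); lra.
  have [|c [d1 d2 dn]] := @neumann _ _ (1 - G); first lra.
  rewrite opprB addrC subrK in d1 d2.
  have cE : c = 1 - w by have := congr1 ( *%R^~ (1 - w)) d2; rewrite /= -mulrA g2 mulr1 mul1r.
  have c2 : anorm c <= 2.
    apply: le_trans dn _; rewrite -[leRHS]invrK lef_pV2 ?posrE ?invr_gt0; lra.
  have -> : w = 1 - c by rewrite cE opprB addrC subrK.
  by apply: le_trans (ler_anormB _ _) _; rewrite anorm1; lra.
(* two steps of length 1 / K change the resolvents by at most 1 / 4 *)
have [K hK] : exists K : nat, 8 * L + 1 <= K%:R.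
  exists (Num.truncn (8 * L + 1)).+1; apply: ltW; apply: truncnS_gt.
have K0 : (0 : R) < K%:R by lra.
have ZB (j : nat) : (j < K)%N -> Z (j%:R / K%:R).
  elim: j => [_|j IH jK].
    move=> e e0; exists 0%N => k _.
    by rewrite mul0r scale0r expr0n -(subnKC (expn_gt0 2 k)) anorm0.
  have jK' : (j.+2 <= K)%N by [].
  have jR : j.+2%:R <= K%:R :> R by rewrite ler_nat.
  apply: (@Z_of_B _ (j.+2%:R / K%:R)).
    by rewrite divr_ge0 ?ltW //= ltr_pM2r ?invr_gt0 // ltr_nat.
  apply: (@B_of_Z (j%:R / K%:R)).
  - by rewrite divr_ge0 // ltW.
  - by rewrite ler_pM2r ?invr_gt0 // ler_nat ltnW.
  - by rewrite ler_pdivrMr // mul1r.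
  - have -> : L * (j.+2%:R / K%:R - j%:R / K%:R) = L * 2 / K%:R.
      by rewrite -(addn2 j) natrD; field; lra.
    by rewrite ler_pdivrMr //; lra.
  - by apply: IH; exact: ltnW.
have K1 : (0 < K)%N by rewrite -(ltr_nat R).
apply: (@B_of_Z (K.-1%:R / K%:R)).
- by rewrite divr_ge0 // ltW.
- by rewrite ler_pdivrMr // mul1r ler_nat leq_pred.
- by [].
- have eK : K.-1%:R = K%:R - 1 :> R by rewrite -{2}(prednK K1) -addn1 natrD addrK.
  have -> : L * (1 - K.-1%:R / K%:R) = L / K%:R by rewrite eK; field; lra.
  by rewrite ler_pdivrMr //; lra.
- by apply: ZB; rewrite prednK.
Qed.
End PowerBounded.

(** The half of the spectral radius formula that is needed: exponents that are
    powers of two suffice both for self-adjoint elements, whose norm is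
    multiplicative along them, and for finding one small power. *)
Lemma spectral_radius_bound x (rho : R) : 0 < rho ->
  (forall l, rho <= cabs l -> invertible (x - l%:A)) ->
  exists N, forall k, (N <= k)%N -> anorm (x ^+ (2 ^ k)) <= 3 * rho ^+ (2 ^ k).
Proof.
move=> r0 hx.
have rC : rho%:C != 0 :> R[i] by rewrite fmorph_eq0 gt_eqF.
have [|N hN] := @dyadic_powers_bounded (rho^-1%:C *: x).
  move=> mu mu1; have [->|mu0] := eqVneq mu 0.
    by rewrite scale0r subr0; exact: invertible1.
  have -> : 1 - mu *: (rho^-1%:C *: x) =
            (- (mu / rho%:C)) *: (x - (rho%:C / mu)%:A).
    have e : mu / rho%:C * (rho%:C / mu) = 1 by rewrite mulrA divfK // mulfV.
    by rewrite scalerBr !scalerA !mulNr e scaleN1r opprK scaleNr addrC fmorphV.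
  apply: invertibleZ; first by rewrite oppr_eq0 mulf_neq0 ?invr_eq0.
  apply: hx; rewrite cabsM cabsV cabsR gtr0_norm // ler_pdivlMr.
    by rewrite ler_piMr // ltW.
  by rewrite lt_def cabs_eq0 mu0 cabs_ge0.
exists N => k /hN; rewrite exprZn -rmorphXn /= anormZr exprVn.
rewrite ger0_norm; last by rewrite invr_ge0 exprn_ge0 // ltW.
by rewrite ler_pdivrMl ?exprn_gt0 // mulrC.
Qed.
End SpectralRadius.

(** * Positive elements and square roots *)

Section Positivity.
Variables (R : realType) (A : cstarAlgType R).
Implicit Types (x y z a b c : A) (t : R) (l mu : R[i]).

Lemma star_alg t : star (t%:C%:A : A) = t%:C%:A.
Proof. by rewrite starZr star1. Qed.

Lemma alg_sqr_diff x l : (x - l%:A) * (x + l%:A) = x * x - (l * l)%:A.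
Proof.
rewrite mulrBl !mulrDr -!scalerAl -!scalerAr !mul1r !mulr1 scalerA.
by rewrite opprD addrA addrK.
Qed.

Lemma sa_anorm_exp2 x k : star x = x -> anorm (x ^+ (2 ^ k)) = anorm x ^+ (2 ^ k).
Proof.
move=> sx; elim: k => [|k IH]; first by rewrite !expr1.
have := cstar_identity (x ^+ (2 ^ k)).
by rewrite starX sx IH -expr2 -!exprM -expnSr.
Qed.

Lemma sa_anorm_le x (rho : R) : star x = x -> 0 < rho ->
  (forall l, rho <= cabs l -> invertible (x - l%:A)) -> anorm x <= rho.
Proof.
move=> sx r0 /(spectral_radius_bound r0) [N hN].
rewrite leNgt; apply/negP => h.
have x0 : 0 < anorm x by apply: lt_trans h.
have q0 : 0 <= rho / anorm x by rewrite divr_ge0 ?ltW.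
have q1 : rho / anorm x < 1 by rewrite ltr_pdivrMr // mul1r.
have [|N' hN'] := expr_eventually_lt q0 q1 (_ : 0 < 1 / 3); first by lra.
have := hN (maxn N N') (leq_maxl _ _).
have le2 : (N' <= 2 ^ maxn N N')%N.
  by apply: leq_trans (ltnW (ltn_expl _ _)) => //; exact: leq_maxr.
have := hN' _ le2; rewrite expr_div_n sa_anorm_exp2 // ltr_pdivrMr ?exprn_gt0 //.
move: (_ ^+ _) (_ ^+ _) => p q; lra.
Qed.

Lemma complex_real_eq l : complex.Im l = 0 -> l = (complex.Re l)%:C.
Proof. by case: l => u v /= ->. Qed.

(** If a + ib is in the spectrum of x, then a + i(b + t) is in that of x + it,
    whose squared norm is at most |x|^2 + t^2.  So a^2 + (b + t)^2 is at most
    |x|^2 + t^2 for all real t, and b = 0. *)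
Lemma sa_spectrum_real x l : star x = x -> spectrum x l -> complex.Im l = 0.
Proof.
move=> sx hl; apply/eqP; apply: contrapT => /negP b0.
set al := complex.Re l; set be := complex.Im l in b0.
have key t : al ^+ 2 + (be + t) ^+ 2 <= anorm x ^+ 2 + t ^+ 2.
  pose y := x + ('i%C * t%:C)%:A.
  have ny : anorm y ^+ 2 <= anorm x ^+ 2 + t ^+ 2.
    rewrite -cstar_identity /y starD sx starZ star1 rmorphM /= conj_real.
    have -> : ('i%C : R[i])^* = - 'i%C by rewrite complexiE conjCi.
    rewrite mulNr scaleNr alg_sqr_diff mulrACA -[_ * 'i%C]expr2 sqr_i mulN1r scaleNr.
    rewrite opprK -rmorphM /= -!expr2; apply: le_trans (ler_anormD _ _) _.
    rewrite anorm_alg ger0_norm ?sqr_ge0 // lerD2r; exact: ler_anormX.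
  have : ~ invertible (y - (l + 'i%C * t%:C)%:A).
    by rewrite /y scalerDl opprD addrACA subrr addr0.
  move=> /(contra_not (@invertible_gt_anorm _ _ _ _)) /negP; rewrite -leNgt => h.
  apply: le_trans ny; apply: (@le_trans _ _ (cabs (l + 'i%C * t%:C) ^+ 2)).
    rewrite -lecR rmorphXn /= cabsE -add_Re2_Im2 lecR.
    by rewrite [l]complexE /= -/al -/be !(mul0r, mulr0, mul1r, subr0, add0r, addr0, oppr0).
  by rewrite ler_sqr ?nnegrE ?cabs_ge0 ?anorm_ge0.
have := key ((anorm x ^+ 2 + 1) / (2 * be)).
set t := _ / _; have tb : 2 * be * t = anorm x ^+ 2 + 1.
  by rewrite mulrC divfK // mulf_neq0.
have := sqr_ge0 al; have := sqr_ge0 be; rewrite !expr2 in tb *; lra.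
Qed.

Lemma pos_sa a : is_positive a -> star a = a.
Proof. by case. Qed.

(** Together with [anorm_of_pos], this describes positivity by a norm
    inequality, from which sums of positive elements are seen to be positive. *)
Lemma pos_of_anorm x t : star x = x -> anorm (t%:C%:A - x) <= t -> is_positive x.
Proof.
move=> sx h; split=> // l hl; have im := sa_spectrum_real sx hl.
move: hl; rewrite (complex_real_eq im); move: (complex.Re l) => u hu.
have : ~ invertible (t%:C%:A - x - (t - u)%:C%:A).
  by rewrite rmorphB /= scalerBl opprB addrC addrA subrK -opprB => /invertibleN.
move=> /(contra_not (@invertible_gt_anorm _ _ _ _)) /negP; rewrite -leNgt.
rewrite -/(cabs _) cabsR ler0c => h2.
have := ler_norm (t - u); lra.
Qed.

Lemma anorm_of_pos x t : is_positive x -> anorm x <= t -> anorm (t%:C%:A - x) <= t.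
Proof.
move=> [sx px] xt; apply/ler_addgt0Pr => e e0.
have t0 : 0 <= t by apply: le_trans xt; exact: anorm_ge0.
apply: sa_anorm_le; [by rewrite starB star_alg sx|lra|] => l hl.
apply: contrapT => hn.
have sp : spectrum x (t%:C - l).
  rewrite /spectrum /= -invertibleN opprB scalerBl => h; apply: hn.
  by rewrite addrAC.
have := px _ sp; rewrite subr_ge0 => lt.
have im : complex.Im l = 0 by move: lt; rewrite lecE /= => /andP[/eqP->].
move: lt sp hl hn; rewrite (complex_real_eq im); move: (complex.Re l) => u.
rewrite lecR -rmorphB cabsR => ut.
move=> /(contra_not (@invertible_gt_anorm _ _ _ _)) /negP; rewrite -leNgt.
rewrite -/(cabs _) cabsR ger0_norm ?subr_ge0 // => h1.
rewrite ger0_norm; last lra.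
by move=> h2; have := le_trans h2 ut; rewrite gerDl leNgt e0.
Qed.

Lemma pos_add x y : is_positive x -> is_positive y -> is_positive (x + y).
Proof.
move=> px py; apply: (@pos_of_anorm _ (anorm x + anorm y)).
  by rewrite starD !pos_sa.
rewrite rmorphD /= scalerDl opprD addrACA; apply: le_trans (ler_anormD _ _) _.
by apply: lerD; exact: anorm_of_pos.
Qed.

Lemma pos_scale t x : 0 <= t -> is_positive x -> is_positive (t%:C *: x).
Proof.
move=> t0 px; apply: (@pos_of_anorm _ (t * anorm x)).
  by rewrite starZr pos_sa.
rewrite rmorphM /= -scalerA -scalerBr anormZr ger0_norm //.
by apply: ler_wpM2l => //; exact: anorm_of_pos.
Qed.

Lemma pos_alg_sub x t : star x = x -> anorm x <= t -> is_positive (t%:C%:A - x).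
Proof.
move=> sx xt; apply: (@pos_of_anorm _ t); first by rewrite starB star_alg sx.
by rewrite opprB addrC subrK.
Qed.

Lemma pos_invertible x t : is_positive x -> 0 < t -> invertible (x + t%:C%:A).
Proof.
move=> [_ px] t0; apply: contrapT => hn.
have /px : spectrum x (- t%:C) by rewrite /spectrum /= scaleNr opprK.
by rewrite oppr_ge0 -[0]/(0%:C) lecR leNgt t0.
Qed.

(** A square root mu of a spectral value of x^2 makes x - mu or x + mu
    non-invertible, so mu is real. *)
Lemma sqr_pos x : star x = x -> is_positive (x * x).
Proof.
move=> sx; split; first by rewrite starM sx.
move=> l hl; pose mu := sqrtC l.
have lE : l = mu * mu by rewrite -expr2 sqrtCK.
have fac : x * x - l%:A = (x - mu%:A) * (x + mu%:A).
  by rewrite alg_sqr_diff -lE.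
have im : complex.Im mu = 0.
  apply: contrapT => im; apply: hl; rewrite fac; apply: invertibleM.
    by apply: contrapT => h; apply: im; exact: (sa_spectrum_real sx h).
  apply: contrapT => h; have /(sa_spectrum_real sx) : spectrum x (- mu).
    by rewrite /spectrum /= scaleNr opprK.
  by move: im; case: (mu) => u v /= hv /eqP; rewrite oppr_eq0 => /eqP.
by rewrite lE (complex_real_eq im) -rmorphM -[0]/(0%:C) lecR -expr2 sqr_ge0.
Qed.

Lemma pos_antisym x : is_positive x -> is_positive (- x) -> x = 0.
Proof.
move=> [sx px] [_ pnx]; apply: anorm_le0; apply/ler_addgt0Pr => e e0.
rewrite add0r; apply: sa_anorm_le => // l hl; apply: contrapT => hn.
have l0 := px _ hn.
have : spectrum (- x) (- l).
  rewrite /spectrum /= scaleNr opprK => h; apply: hn.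
  by apply/invertibleN; rewrite opprB addrC.
move=> /pnx; rewrite oppr_ge0 => l1.
have lz : l = 0 by apply/eqP; rewrite eq_le l0 l1.
by move: hl; rewrite lz cabsR normr0 leNgt e0.
Qed.

Section SquareRoot.
Variable h : A.
Hypotheses (sh : star h = h) (h1 : anorm h <= 1).

Let g n : A := iter n (fun u => (1 / 2)%:C *: (h + u * u)) 0.
Let gam n : R := iter n (fun u => (1 / 2) * (1 + u * u)) 0.

Let gam_bound n : 0 <= gam n <= 1.
Proof.
elim: n => [|n /andP[IH1 IH2]]; first by rewrite /= lexx ler01.
rewrite /gam iterS -/(gam n); move: (gam n) IH1 IH2 => u u0 u1.
have : u * u <= 1 by rewrite mulr_ile1.
have : 0 <= u * u by rewrite mulr_ge0.
by move=> ? ?; apply/andP; split; lra.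
Qed.

Let g_comm y : h * y = y * h -> forall n, g n * y = y * g n.
Proof.
move=> hy; elim=> [|n IH]; first by rewrite mul0r mulr0.
rewrite /g iterS -/(g n) -scalerAl -scalerAr; congr (_ *: _).
by rewrite mulrDl mulrDr hy -mulrA IH mulrA IH -mulrA.
Qed.

Let g_comm_g m n : g m * g n = g n * g m.
Proof. by apply: g_comm; rewrite g_comm. Qed.

Let g_sa n : star (g n) = g n.
Proof.
elim: n => [|n IH]; first by rewrite star0.
by rewrite /g iterS -/(g n) starZr starD starM IH sh.
Qed.

Let g_bound n : anorm (g n) <= gam n.
Proof.
elim: n => [|n IH]; first by rewrite anorm0.
rewrite /g /gam !iterS -/(g n) -/(gam n) anormZr ger0_norm; last lra.
apply: ler_wpM2l; first lra.
apply: le_trans (ler_anormD _ _) _; apply: lerD => //.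
by apply: le_trans (ler_anormM _ _) _; apply: ler_pM => //; exact: anorm_ge0.
Qed.

Let g_dist n k : anorm (g (n + k)%N - g n) <= gam (n + k)%N - gam n.
Proof.
elim: n => [|n IH]; first by rewrite !subr0.
rewrite addSn /g /gam !iterS -/(g _) -/(gam _) -/(g _) -/(gam _).
rewrite -mulrBr -scalerBr anormZr ger0_norm; last lra.
apply: ler_wpM2l; first lra.
rewrite !opprD !addrA ![_ + _ - h]addrAC subrr add0r ![_ + _ - 1]addrAC subrr add0r.
have -> : g (n + k) * g (n + k) - g n * g n = (g (n + k) - g n) * (g (n + k) + g n).
  by rewrite mulrBl !mulrDr (g_comm_g n (n + k)) opprD addrA addrK.
have -> : gam (n + k) * gam (n + k) - gam n * gam n =
          (gam (n + k) - gam n) * (gam (n + k) + gam n) by ring.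
apply: le_trans (ler_anormM _ _) _; apply: ler_pM => //; try exact: anorm_ge0.
by apply: le_trans (ler_anormD _ _) _; apply: lerD.
Qed.

(** The iteration g -> (h + g^2) / 2 started at 0 converges to w with
    (1 - w)^2 = 1 - h.  It is dominated by the scalar iteration for h = 1, which
    increases to 1; this covers the boundary case |h| = 1, where the
    iteration need not be a contraction, and hence non-invertible elements. *)
Lemma sqrt_one_sub : exists s, [/\ is_positive s, s * s = 1 - h &
  forall y, h * y = y * h -> s * y = y * s].
Proof.
have [|n|w hw] := @acvg_dominated _ _ g gam 1.
- by move=> m n /subnKC <-; exact: g_dist.
- by case/andP: (gam_bound n).
have w1 : anorm w <= 1.
  apply: acvg_anorm_le hw => n; apply: le_trans (g_bound n) _.
  by case/andP: (gam_bound n).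
have sw : star w = w.
  apply: acvg_unique (acvg_star hw) _ => e /hw [N hN].
  by exists N => n /hN; rewrite g_sa.
have wE : w = (1 / 2)%:C *: (h + w * w).
  apply: acvg_unique (acvg_shift hw) _ => e e0.
  have [N hN] := hw e e0; exists N => n /hN.
  rewrite /g iterS -/(g n) => hn.
  rewrite -scalerBr opprD addrACA subrr add0r anormZr ger0_norm; last lra.
  have -> : g n * g n - w * w = g n * (g n - w) + (g n - w) * w.
    by rewrite mulrBr mulrBl addrA subrK.
  have := ler_anormD (g n * (g n - w)) ((g n - w) * w).
  have := ler_anormM (g n) (g n - w); have := ler_anormM (g n - w) w.
  have gn1 : anorm (g n) <= 1.
    by apply: le_trans (g_bound n) _; case/andP: (gam_bound n).
  have d0 := anorm_ge0 (g n - w).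
  have := ler_pM (anorm_ge0 (g n)) d0 gn1 (lexx _).
  have := ler_pM d0 (anorm_ge0 w) (lexx _) w1.
  by rewrite mulr1 mul1r; lra.
exists (1 - w); split.
- apply: (@pos_of_anorm _ 1); first by rewrite starB star1 sw.
  by rewrite scale1r opprB addrC subrK.
- have w2 : w + w = h + w * w.
    rewrite {1 2}wE -scalerDl -rmorphD /=.
    by rewrite (_ : 1 / 2 + 1 / 2 = 1) ?scale1r //; lra.
  rewrite mulrBr mulr1 mulrBl mul1r opprB.
  have -> : w * w = w + w - h by rewrite w2 addrC addKr.
  by rewrite [w + w - h - w]addrAC addrK addrA subrK.
- move=> y hy; rewrite mulrBl mulrBr mul1r mulr1; congr (_ - _).
  apply: (acvg_unique (acvg_mulr y hw)) => e /(acvg_mull y hw) [N hN].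
  by exists N => n /hN; rewrite g_comm.
Qed.
End SquareRoot.

Lemma pos_sqrt a : is_positive a -> exists s,
  [/\ is_positive s, s * s = a & forall y, a * y = y * a -> s * y = y * s].
Proof.
move=> pa; have sa := pos_sa pa.
pose t := anorm a + 1; have t0 : 0 < t by rewrite ltr_wpDl ?anorm_ge0.
have tC : t%:C != 0 :> R[i] by rewrite fmorph_eq0 gt_eqF.
pose h := 1 - t^-1%:C *: a.
have hE : h = t^-1%:C *: (t%:C%:A - a).
  by rewrite scalerBr scalerA -rmorphM mulVf ?gt_eqF // scale1r.
have [||s [ps ss cs]] := @sqrt_one_sub h.
- by rewrite starB star1 starZr sa.
- rewrite hE anormZr gtr0_norm ?invr_gt0 // ler_pdivrMl // mulr1.
  by apply: anorm_of_pos => //; rewrite lerDl.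
exists ((Num.sqrt t)%:C *: s); split.
- by apply: pos_scale; rewrite ?sqrtr_ge0.
- rewrite -scalerAl -scalerAr scalerA -rmorphM /= -expr2 sqr_sqrtr; last exact: ltW.
  rewrite ss.
  by rewrite opprB addrC subrK scalerA -rmorphM mulfV ?gt_eqF // scale1r.
- move=> y hy; rewrite -scalerAl -scalerAr cs //.
  by rewrite mulrBl mulrBr mul1r mulr1 -scalerAl -scalerAr hy.
Qed.

(** Jacobson's identity: if b inverts xy - l, then (y b x - 1) / l inverts
    yx - l. *)
Lemma invertible_swap x y l : l != 0 ->
  invertible (x * y - l%:A) -> invertible (y * x - l%:A).
Proof.
move=> l0 [b [h1 h2]].
have lVl : l^-1 * l = 1 by rewrite mulVf.
exists (l^-1 *: (y * b * x - 1)); split.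
- rewrite -scalerAr mulrBr mulr1.
  have e : (y * x - l%:A) * y = y * (x * y - l%:A).
    by rewrite mulrBr mulrBl mulrA -scalerAr -scalerAl mulr1 mul1r.
  have -> : (y * x - l%:A) * (y * b * x) = y * x.
    by rewrite !mulrA e -(mulrA y) h1 mulr1.
  by rewrite opprB addrC subrK scalerA lVl scale1r.
- rewrite -scalerAl mulrBl mul1r.
  have e : x * (y * x - l%:A) = (x * y - l%:A) * x.
    by rewrite mulrBr mulrBl mulrA -scalerAr -scalerAl mulr1 mul1r.
  have -> : (y * b * x) * (y * x - l%:A) = y * x.
    by rewrite -mulrA e mulrA -(mulrA y) h2 mulr1.
  by rewrite opprB addrC subrK scalerA lVl scale1r.
Qed.
End Positivity.

(** * Positivity of squares *)

Section StarSquares.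
Variables (R : realType) (A : cstarAlgType R).
Implicit Types (x y z a b c k : A) (t : R) (l mu : R[i]).

Lemma half_double x : (1 / 2)%:C *: (x + x) = x.
Proof.
rewrite scalerDr -scalerDl -rmorphD /= (_ : 1 / 2 + 1 / 2 = 1 :> R) ?scale1r //.
lra.
Qed.

Lemma double_inj x y : x + x = y + y -> x = y.
Proof. by move=> h; rewrite -(half_double x) h half_double. Qed.

(** xy and yx have the same nonzero spectrum, so y star(y) is negative too.
    The sum star(y) y + y star(y) is thus negative, but it is also half the sum
    of the squares of the self-adjoint elements y + star(y) and
    i (y - star(y)). *)
Lemma star_mul_neg y : is_positive (- (star y * y)) -> y = 0.
Proof.
move=> p1.
have p2 : is_positive (- (y * star y)).
  split; first by rewrite starN starM starK.
  move=> l hl; have [->//|l0] := eqVneq l 0.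
  case: p1 => _; apply=> h; apply: hl.
  have {}h : invertible (star y * y - (- l)%:A).
    by apply/invertibleN; rewrite scaleNr opprK opprD.
  apply/invertibleN; rewrite opprD !opprK -[l%:A]opprK -scaleNr.
  by apply: invertible_swap h; rewrite oppr_eq0.
pose p := y + star y; pose q := 'i%C *: (y - star y).
have sp : star p = p by rewrite /p starD starK addrC.
have sq : star q = q.
  rewrite /q starZ starB starK -opprB scalerN -scaleNr.
  by congr (_ *: _); rewrite complexiE conjCi opprK.
have pq : p * p + q * q = (star y * y + y * star y) + (star y * y + y * star y).
  rewrite /p /q -scalerAl -scalerAr scalerA -[_ * 'i%C]expr2 sqr_i scaleN1r.
  rewrite mulrBl !mulrBr mulrDl !mulrDr.
  move: (y * y) (star y * star y) (y * star y) (star y * y) => a b c d.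
  rewrite opprB opprB [d - b + _]addrC addrACA [a + c]addrC [c + a + _]addrACA.
  by rewrite subrr addr0 [d + b + _]addrACA subrr addr0 addrACA [c + d]addrC.
have npq : is_positive (- (p * p + q * q)).
  by rewrite pq !opprD; do !apply: pos_add.
have pq0 := pos_antisym (pos_add (sqr_pos sp) (sqr_pos sq)) npq.
have qE : q * q = - (p * p) by apply/eqP; rewrite -addr_eq0 addrC pq0.
have p0 : p = 0.
  apply: star_mul_eq0; rewrite sp; apply: pos_antisym; first exact: sqr_pos.
  by rewrite -qE; exact: sqr_pos.
have q0 : q = 0.
  by apply: star_mul_eq0; rewrite sq qE p0 mulr0 oppr0.
have ys : y = star y.
  have i0 : 'i%C != 0 :> R[i] by rewrite -cabs_eq0 cabs_i oner_eq0.
  by move/eqP: q0; rewrite scaler_eq0 (negbTE i0) /= subr_eq0 => /eqP.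
by apply: double_inj; rewrite addr0 {2}ys.
Qed.

(** Let a = star(y) y, s = |a| the square root of a^2, and u = s - a, twice the
    negative part of a.  It is positive because u (s + a) = 0 and
    u + (s + a) = 2 s.  With z = y u
    one gets 2 star(z) z = 2 u a u = - u^3, so z = 0 by [star_mul_neg], whence
    u = 0 and a = s. *)
Lemma star_mul_pos y : is_positive (star y * y).
Proof.
set a := star y * y.
have sa : star a = a by rewrite /a starM starK.
have [s [ps ss cs]] := pos_sqrt (sqr_pos sa).
have ssa := pos_sa ps.
have sc : s * a = a * s by apply: cs; rewrite mulrA.
pose u := s - a; pose v := s + a.
have su : star u = u by rewrite /u starB ssa sa.
have uv : u * v = 0.
  by rewrite /u /v mulrBl !mulrDr ss sc opprD addrA addrK subrr.
have vu : v * u = 0.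
  by rewrite /u /v mulrDl !mulrBr ss sc addrA subrK subrr.
have uav : u + v = s + s by rewrite /u /v addrACA addNr addr0.
have pu : is_positive u.
  split=> // l hl; have im := sa_spectrum_real su hl.
  move: hl; rewrite (complex_real_eq im) ler0c; move: (complex.Re l) => t hl.
  rewrite leNgt; apply/negP => t0; apply: hl.
  (* (u - t) (v - t) = - t (2 s - t) is invertible when t < 0 *)
  have prod w w' : w * w' = 0 -> w + w' = s + s ->
      (w - t%:C%:A) * (w' - t%:C%:A) = (- t)%:C *: ((s + s) + (- t)%:C%:A).
    move=> ww' <-; rewrite mulrBl !mulrBr -!scalerAl -!scalerAr !mul1r !mulr1 ww'.
    rewrite sub0r opprB [_ - t%:C *: w']addrC addrA.
    by rewrite !scalerDr !scalerA rmorphN /= mulrNN !scaleNr.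
  apply: (@invertible_comm_mul _ _ _ (v - t%:C%:A)).
    by rewrite (prod _ _ uv uav) (prod _ _ vu) // addrC.
  rewrite (prod _ _ uv uav); apply: invertibleZ.
    by rewrite fmorph_eq0 oppr_eq0 lt_eqF.
  by apply: pos_invertible; rewrite ?oppr_gt0 //; exact: pos_add.
have [r [pr rr cr]] := pos_sqrt pu.
have sr := pos_sa pr.
have ur : u * r = r * u by rewrite -rr mulrA.
pose z := y * u.
have zz : star z * z + star z * z = - (u * u * u).
  rewrite /z starM su mulrA -[u * star y * y]mulrA -/a -mulrDl -mulrDr.
  have -> : a + a = v - u by rewrite /v /u opprB [RHS]addrC addrA subrK.
  by rewrite (mulrBr u v u) uv sub0r mulNr.
have z0 : z = 0.
  apply: star_mul_neg; rewrite -[_ * z]half_double zz scalerN opprK.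
  apply: pos_scale; first lra.
  have -> : u * u * u = (u * r) * (u * r).
    by rewrite {2}ur mulrA -[u * r * r]mulrA rr.
  by apply: sqr_pos; rewrite starM su sr ur.
have u3 : u * u * u = 0.
  by apply/eqP; rewrite -oppr_eq0 -zz z0 mulr0 addr0.
have u0 : u = 0.
  apply: star_mul_eq0; rewrite su; apply: star_mul_eq0.
  by rewrite starM su mulrA u3 mul0r.
by have -> : a = s by apply/esym/eqP; rewrite -subr_eq0 -/u u0.
Qed.

Lemma conj_pos b c : is_positive b -> is_positive (star c * b * c).
Proof.
move=> /pos_sqrt [s [ps <- _]].
have -> : star c * (s * s) * c = star (s * c) * (s * c).
  by rewrite starM (pos_sa ps) !mulrA.
exact: star_mul_pos.
Qed.

Lemma pos_compression_eq0 a k : is_positive a -> is_positive (- (star k * a * k)) ->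
  a * k = 0.
Proof.
move=> /pos_sqrt [s [ps <- _]] h; rewrite -mulrA.
suff -> : s * k = 0 by rewrite mulr0.
by apply: star_mul_neg; rewrite starM (pos_sa ps) -!mulrA mulrA in h *.
Qed.

(** The elements x h with h = (star(x) x)^(-1/2) are isometries.  Here
    star(x) x is invertible because star(x) (|z|^2 - star(z) z) x is positive
    and equals |z|^2 star(x) x - 1. *)
Lemma left_invertible_normalization x z : z * x = 1 -> exists h,
  star h = h /\ h * (star x * x) * h = 1.
Proof.
move=> zx; set a := star x * x.
have pa : is_positive a := star_mul_pos x.
have sa := pos_sa pa.
pose N := anorm (star z * z).
have pN : is_positive (N%:C *: a - 1).
  have := conj_pos x (@pos_alg_sub _ _ (star z * z) N _ (lexx _)).
  rewrite starM starK => /(_ erefl).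
  rewrite mulrBr mulrBl -scalerAr mulr1 -scalerAl -/a.
  have -> : star x * (star z * z) * x = star (z * x) * (z * x).
    by rewrite starM !mulrA.
  by rewrite zx star1 mulr1.
have iN : invertible (N%:C *: a).
  by have := pos_invertible pN ltr01; rewrite scale1r subrK.
have N0 : N%:C != 0.
  apply: contraTneq isT => N0; move: iN; rewrite N0 scale0r => -[w [w0 _]].
  by move/eqP: w0; rewrite mul0r eq_sym oner_eq0.
have {iN} ia : invertible a by apply/(invertibleZP _ N0).
have [s [ps ss _]] := pos_sqrt pa; have ssa := pos_sa ps.
have [|h [sh hs]] := @invertible_comm_mul _ _ s s erefl; first by rewrite ss.
have sth : star h = h.
  have : star h * s = 1 by rewrite -{1}ssa -starM sh star1.
  by move=> /(congr1 ( *%R^~ h)); rewrite /= -mulrA sh mulr1 mul1r.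
by exists h; split=> //; rewrite -ss mulrA hs mul1r sh.
Qed.
End StarSquares.

(** * Distance to the quasinilpotents: lower bounds *)

Section LowerBound.
Variables (R : realType) (A : cstarAlgType R).
Implicit Types (x y z a b c k p q : A) (t : R) (l mu : R[i]).

(** The Lyapunov argument: S = 2p - 1 would satisfy S <= star(W^n) S W^n with
    W^n arbitrarily small, so that p = p S p <= p / 2. *)
Lemma quasinil_anorm_ge p q : is_projection p -> p <> 0 ->
  quasinilpotents A q -> 1 / 2 <= anorm (p - q).
Proof.
move=> [sp pp] p0 hq; rewrite leNgt; apply/negP => hlt; apply: p0.
pose S := p + p - 1; pose T := q + q - 1; pose d := anorm (S - T).
have sS : star S = S by rewrite /S starB starD sp star1.
have SS : S * S = 1.
  by rewrite /S mulrBr mulrBl mulrDl mulrDr pp mulr1 mul1r addrK opprB addrC subrK.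
have Sp : S * p = p by rewrite /S mulrBl mulrDl pp mul1r addrK.
have nS : anorm S = 1.
  have := cstar_identity S; rewrite sS SS anorm1 => /esym/eqP.
  by rewrite sqrp_eq1 ?anorm_ge0 // => /eqP.
have d1 : d < 1.
  have -> : d = anorm ((p - q) + (p - q)).
    rewrite /d /S /T; congr anorm.
    by rewrite opprB addrA subrK opprD addrACA.
  by apply: le_lt_trans (ler_anormD _ _) _; lra.
have d0 : 0 <= d by exact: anorm_ge0.
have TE : T = q + q - 1 by [].
clearbody S T.
pose K := S * (S - T).
have nK : anorm K <= d.
  by apply: le_trans (ler_anormM _ _) _; rewrite nS mul1r.
have ST : S * T = 1 - K by rewrite /K (mulrBr S S T) SS opprB addrC subrK.
have TS : star T * S = 1 - star K by rewrite -{1}sS -starM ST starB star1.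
have pG : is_positive ((2 * d)%:C%:A - (K + star K)).
  apply: pos_alg_sub; first by rewrite starD starK addrC.
  by apply: le_trans (ler_anormD _ _) _; rewrite anorm_star; lra.
(* h is small enough for the linear term of star(W) S W - S to
   dominate h^2 star(T) S T *)
pose tau := anorm (star T * S * T).
have tau0 : 0 <= tau by exact: anorm_ge0.
pose h := (1 - d) / (tau + 2).
have h0 : 0 < h by apply: divr_gt0; lra.
have h1 : h <= 1 / 2.
  by rewrite ler_pdivrMr; lra.
have htau : h * tau <= 2 - 2 * d.
  have e : h * (tau + 2) = 1 - d by rewrite divfK // gt_eqF //; lra.
  lra.
pose W := 1 + h%:C *: T.
have pW : is_positive (star W * S * W - S).
  have -> : star W * S * W - S =
      h%:C *: (((2 * d)%:C%:A - (K + star K)) +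
               ((2 - 2 * d)%:C%:A - (- (h%:C *: (star T * S * T))))).
    have -> : (2 * d)%:C%:A - (K + star K) +
        ((2 - 2 * d)%:C%:A - - (h%:C *: (star T * S * T))) =
        S * T + star T * S + h%:C *: (star T * S * T).
      rewrite opprK addrA [_ - _ + (2 - _)%:C%:A]addrAC -scalerDl -rmorphD /=.
      rewrite [2 * d + _]addrC subrK ST TS addrACA -opprD.
      by rewrite -[2]/(1 + 1) rmorphD scalerDl scale1r.
    rewrite /W starD star1 starZr [(1 + _) * S]mulrDl mul1r mulrDr mulr1.
    rewrite [_ * (_ *: T)]mulrDl -!scalerAl -!scalerAr !scalerDr.
    by rewrite addrC -addrA addKr addrA [h%:C *: (S * T) + _]addrC.
  apply: pos_scale; first exact: ltW.
  apply: pos_add => //; apply: pos_alg_sub.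
    by rewrite starN starZr !starM starK sS mulrA.
  by rewrite anormN anormZr gtr0_norm.
have pWn n : is_positive (star (W ^+ n) * S * W ^+ n - S).
  elim: n => [|n IH].
    by rewrite expr0 star1 mul1r mulr1 subrr -(scale0r 1); apply: (@pos_of_anorm _ _ _ 0); rewrite ?scale0r ?star0 // subrr anorm0.
  have -> : star (W ^+ n.+1) * S * W ^+ n.+1 - S =
      star W * (star (W ^+ n) * S * W ^+ n - S) * W + (star W * S * W - S).
    by rewrite mulrBr mulrBl addrA subrK exprSr starM !mulrA.
  by apply: pos_add => //; exact: conj_pos.
have [n hn] : exists n, anorm (W ^+ n) <= 1 / 2.
  (* any radius strictly between 1 - h, the spectrum of W, and 1 *)
  pose rho := 1 - h / 2.
  have rho0 : 0 <= rho by rewrite /rho; lra.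
  have rho1 : rho < 1 by rewrite /rho; lra.
  have [||N hN] := @spectral_radius_bound _ _ W rho; first by rewrite /rho; lra.
    move=> l hl; pose mu := (l - (1 - h)%:C) / (2 * h)%:C.
    have h2 : (2 * h)%:C != 0 :> R[i] by rewrite fmorph_eq0 gt_eqF //; lra.
    have mu0 : mu != 0.
      rewrite mulf_neq0 ?invr_eq0 // subr_eq0.
      apply: contraTneq hl => ->; rewrite cabsR ger0_norm /rho -?ltNge; lra.
    have -> : W - l%:A = (2 * h)%:C *: (q - mu%:A).
      rewrite scalerBr scalerA [_ * mu]mulrC divfK // scalerBl /W TE.
      rewrite rmorphB scalerBl scale1r scalerBr.
      have -> : h%:C *: (q + q) = (2 * h)%:C *: q.
        by rewrite scalerDr -scalerDl -rmorphD /= mulrDl mul1r.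
      by rewrite opprB addrCA -addrA.
    apply: invertibleZ => //; apply: contrapT => hs.
    have : spectrum q mu by [].
    by rewrite hq /= => e; rewrite e eqxx in mu0.
  have [|N' hN'] := expr_eventually_lt rho0 rho1 (_ : 0 < 1 / 6); first by lra.
  exists (2 ^ maxn N N')%N; apply: le_trans (hN _ (leq_maxl _ _)) _.
  have /hN' : (N' <= 2 ^ maxn N N')%N.
    by apply: leq_trans (ltnW (ltn_expl _ _)) => //; exact: leq_maxr.
  by move: (_ ^+ _) => u; lra.
pose X := star (W ^+ n) * S * W ^+ n.
have sX : star X = X by rewrite /X !starM starK sS mulrA.
have nX : anorm X <= 1 / 2.
  apply: le_trans (ler_anormM _ _) _.
  have := ler_anormM (star (W ^+ n)) S; rewrite nS anorm_star mulr1 => h3.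
  have := ler_pM (anorm_ge0 _) (anorm_ge0 _) (le_trans h3 hn) hn; lra.
have := pos_add (pos_alg_sub sX nX) (pWn n); rewrite addrA subrK.
move=> /(conj_pos p); rewrite sp mulrBr mulrBl -(mulrA p S) Sp -scalerAr mulr1 -scalerAl !pp.
have -> : (1 / 2)%:C *: p - p = - ((1 / 2)%:C *: p).
  by rewrite -{2}(half_double p) scalerDr opprD addrA subrr sub0r.
have p2 : 0 <= 2 :> R by [].
move=> /(pos_scale p2); rewrite scalerN scalerA -rmorphM /= (_ : 2 * (1 / 2) = 1 :> R).
  by rewrite scale1r -{1}pp -{1}sp; exact: star_mul_neg.
lra.
Qed.

Lemma nilpotent_quasinilpotent x : nilpotents A x -> quasinilpotents A x.
Proof.
move=> [n xn]; apply/seteqP; split=> l /=.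
  move=> hl; apply/eqP; apply: contrapT => /negP l0; apply: hl.
  pose y := l^-1 *: x.
  have yn : y ^+ n = 0 by rewrite exprZn xn scaler0.
  have -> : x - l%:A = (- l) *: (1 - y).
    by rewrite scalerBr scalerA mulNr mulfV // scaleN1r opprK addrC scaleNr.
  apply: invertibleZ; first by rewrite oppr_eq0.
  pose s := \sum_(i < n) y ^+ i.
  have h1 : (1 - y) * s = 1.
    by rewrite -opprB mulNr -subrX1 yn sub0r opprK.
  exists s; split=> //; rewrite -[RHS]h1.
  apply: commr_sym; apply: commr_sum => i _.
  apply: commrX; apply: commr_sym; apply: commrB; [exact: commr1|exact: commr_refl].
move=> -> [y]; rewrite scale0r subr0 => -[xy _].
have : x ^+ n * y ^+ n = 1.
  elim: n {xn} => [|n IH]; first by rewrite mulr1.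
  by rewrite exprSr exprS mulrA -(mulrA _ x) xy mulr1.
by move/eqP; rewrite xn mul0r eq_sym oner_eq0.
Qed.

Lemma quasinil_anorm1_ge q : quasinilpotents A q -> 1 <= anorm (1 - q).
Proof.
move=> hq; rewrite leNgt; apply/negP => /invertible_near1 iq.
have : spectrum q 0 by rewrite hq.
by rewrite /spectrum /= scale0r subr0.
Qed.

(** Both infima are squeezed between the same bounds, as nilpotents are
    quasinilpotent. *)
Lemma dist_nilpotentsE p (c : R) :
  (forall q, quasinilpotents A q -> c <= anorm (p - q)) ->
  (forall e, 0 < e -> exists2 q, nilpotents A q & anorm (p - q) < c + e) ->
  dist_to p (nilpotents A) = c /\ dist_to p (quasinilpotents A) = c.
Proof.
move=> lo up.
suff distE (B : set A) : (nilpotents A `<=` B)%classic ->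
    (B `<=` quasinilpotents A)%classic -> dist_to p B = c.
  by split; apply: distE => // x; exact: nilpotent_quasinilpotent.
move=> NB BQ.
have lb : lbound [set anorm (p - b) | b in B]%classic c.
  by move=> _ [b /BQ hb <-]; exact: lo.
apply/eqP; rewrite eq_le; apply/andP; split.
  apply/ler_addgt0Pr => e /up [q /NB Bq hq]; apply: le_trans (ltW hq).
  by apply: ge_inf; [exists c|exists q].
apply: lb_le_inf => //; have [q /NB Bq _] := up 1 ltr01.
by exists (anorm (p - q)), q.
Qed.
End LowerBound.

(** * Orthogonal isometries in simple purely infinite algebras *)

Section PurelyInfinite.
Variables (R : realType) (A : cstarAlgType R).
Implicit Types (x y z a b c e f k p q v : A) (t : R) (l mu : R[i]).

Lemma star_mul_mul x y z c :
  star (x * y) * (z * c) = star y * (star x * z) * c.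
Proof. by rewrite starM !mulrA. Qed.

Lemma projection_compl p : is_projection p -> is_projection (1 - p).
Proof.
move=> [sp pp]; split; first by rewrite starB star1 sp.
by rewrite mulrBr mulr1 mulrBl mul1r pp subrr subr0.
Qed.

Lemma projection_anorm p : is_projection p -> anorm p <= 1.
Proof.
move=> [sp pp]; rewrite leNgt; apply/negP => h.
have := cstar_identity p; rewrite sp pp => /esym/eqP.
rewrite expr2 -[X in _ == X]mulr1 (inj_eq (mulfI _)) ?gt_eqF //.
by rewrite (lt_trans ltr01).
Qed.

Definition corner p : set A := [set x | p * x = x /\ x * p = x]%classic.

(** If a is below b in the corner of p and k = 1 - p, then - k a k =
    k (b - a) k is positive, so a k = 0. *)
Lemma corner_hereditary p : is_projection p -> hereditary_subalgebra (corner p).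
Proof.
move=> [sp pp]; split; first split.
- apply/norm_closedP => x hx.
  have K0 : 0 < anorm p + 2 by rewrite ltr_wpDl ?anorm_ge0.
  have small y : (forall b, corner p b -> anorm y <= (anorm p + 1) * anorm (x - b)) ->
      y = 0.
    move=> hy; apply: anorm_le0; rewrite leNgt; apply/negP => y0.
    have [|b /hy h1 h2] := hx (anorm y / (anorm p + 2)); first exact: divr_gt0.
    move: h2; rewrite ltr_pdivlMr // => h2.
    have := anorm_ge0 (x - b); rewrite !mulrDl !mulrDr in h1 h2; lra.
  split; apply/eqP; rewrite -subr_eq0; apply/eqP; apply: small => b [pb bp].
    have -> : p * x - x = p * (x - b) - (x - b).
      by rewrite mulrBr pb opprB addrA subrK.
    apply: le_trans (ler_anormB _ _) _; rewrite mulrDl mul1r lerD2r.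
    exact: ler_anormM.
  have -> : x * p - x = (x - b) * p - (x - b).
    by rewrite mulrBl bp opprB addrA subrK.
  apply: le_trans (ler_anormB _ _) _; rewrite [(_ + 1) * _]mulrDl mul1r lerD2r.
  by rewrite [anorm p * _]mulrC; exact: ler_anormM.
- by split; rewrite ?mulr0 ?mul0r.
- split.
  + by move=> x y [px xp] [py yp]; split; rewrite ?mulrDr ?mulrDl ?px ?py ?xp ?yp.
  + by move=> l x [px xp]; split; rewrite -?scalerAr -?scalerAl ?px ?xp.
  + by move=> x y [px xp] [py yp]; split; rewrite ?mulrA ?px // -mulrA yp.
  + by move=> x [px xp]; split; rewrite -{1}sp -starM ?px ?xp.
- move=> a b pa ab [pb bp].
  have [k kE] : exists k, k = 1 - p by exists (1 - p).
  have sk : star k = k by rewrite kE starB star1 sp.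
  have kb : k * b = 0 by rewrite kE mulrBl mul1r pb subrr.
  have ak : a * k = 0.
    apply: pos_compression_eq0 => //; have := conj_pos k ab.
    by rewrite mulrBr mulrBl {1}sk kb mul0r sub0r.
  have ap : a * p = a.
    by apply/esym/eqP; rewrite -subr_eq0 -{1}(mulr1 a) -mulrBr -kE ak.
  by split=> //; rewrite -{2}ap -{1}sp -{1}(pos_sa pa) -starM ap (pos_sa pa).
Qed.

(** The partial isometry v with star(v) v = q and v star(v) < q becomes an
    isometry V = v + (1 - q) of the whole algebra with the same defect
    1 - V star(V) = q - v star(v), a nonzero projection below q. *)
Lemma infinite_projection_isometry q : is_infinite_projection q ->
  exists V, [/\ star V * V = 1, V * star V <> 1, q * V = V * q &
                q * (1 - V * star V) = 1 - V * star V].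
Proof.
move=> [[sq qq] [v [vv le ne]]].
have [k kE] : exists k, k = 1 - q by exists (1 - q).
have sk : star k = k by rewrite kE starB star1 sq.
have qk : q * k = 0 by rewrite kE mulrBr mulr1 qq subrr.
have kk : k * k = k by rewrite {1}kE mulrBl mul1r qk subr0.
have vk : v * k = 0.
  by apply: star_mul_eq0; rewrite starM sk -mulrA (mulrA _ v) vv qk mulr0.
have vq : v * q = v.
  by apply/esym/eqP; rewrite -subr_eq0 -{1}(mulr1 v) -mulrBr -kE vk.
have kv : k * v = 0.
  have pf : is_positive (v * star v) by rewrite -{1}(starK v); exact: star_mul_pos.
  have fk : v * star v * k = 0.
    apply: pos_compression_eq0 => //; have := conj_pos k le.
    by rewrite mulrBr mulrBl -(mulrA _ q) qk mulr0 sub0r.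
  have kf : k * (v * star v) = 0.
    by rewrite -{1}sk -(pos_sa pf) -starM fk star0.
  by rewrite -vq -vv !mulrA -[k * v * _]mulrA kf mul0r.
have qv : q * v = v.
  by apply/esym/eqP; rewrite -subr_eq0 -{1}(mul1r v) -mulrBl -kE kv.
have svk : star v * k = 0 by rewrite -sk -starM kv star0.
have ksv : k * star v = 0 by rewrite -{1}sk -starM vk star0.
have kq : k * q = 0 by rewrite kE mulrBl mul1r qq subrr.
pose V := v + k.
have VV : V * star V = v * star v + k.
  by rewrite /V starD sk mulrDl !mulrDr vk ksv kk addr0 add0r.
have eE : 1 - V * star V = q - v * star v.
  by rewrite VV kE opprD addrA opprB [LHS]addrC addrA subrK.
exists V; split.
- by rewrite /V starD sk mulrDl !mulrDr vv svk kv kk addr0 add0r kE addrC subrK.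
- move=> h; apply: ne; apply/esym/eqP; rewrite -subr_eq0 -eE h subrr //.
- by rewrite /V mulrDr mulrDl qv vq qk kq.
- by rewrite eE mulrBr qq mulrA qv.
Qed.

Section Isometry.
Variable V : A.
Hypothesis VV : star V * V = 1.
Let e := 1 - V * star V.

Lemma isometry_defect_star : star e = e.
Proof. by rewrite /e starB star1 starM starK. Qed.

Lemma isometry_defect_mul : e * V = 0.
Proof. by rewrite /e mulrBl mul1r -mulrA VV mulr1 subrr. Qed.

Lemma isometry_defect_idem : e * e = e.
Proof.
by rewrite {2}/e mulrBr mulr1 mulrA isometry_defect_mul mul0r subr0.
Qed.

Lemma isometry_pow i j : star (V ^+ i) * V ^+ (i + j) = V ^+ j.
Proof.
elim: i => [|i IH]; first by rewrite star1 mul1r.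
by rewrite addSn !exprS starM -mulrA (mulrA (star V)) VV mul1r.
Qed.

(** As in the Wold decomposition, the defect space of an isometry is wandering:
    the elements V^i e are partial isometries with common initial projection e
    and orthogonal ranges. *)
Lemma wandering_orthogonal i j :
  star (V ^+ i * e) * (V ^+ j * e) = e *+ (i == j).
Proof.
have off m n : star (V ^+ m * e) * (V ^+ (m + n.+1) * e) = 0.
  rewrite starM isometry_defect_star -mulrA (mulrA (star _)) isometry_pow exprS.
  by rewrite !mulrA isometry_defect_mul !mul0r.
case: ltngtP => [ij|ij|->].
- by rewrite -(subnKC ij) addSnnS off.
- rewrite -[LHS]starK starM starK.
  by rewrite -(subnKC ij) addSnnS off star0.
- rewrite starM isometry_defect_star -mulrA (mulrA (star _)).
  by rewrite -{2}[j]addn0 isometry_pow expr0 mul1r isometry_defect_idem.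
Qed.
End Isometry.

(** The sums of products x e y are dense in the closed ideal generated by e,
    which contains 1; a sum within distance 1 of 1 is invertible, and its
    inverse is absorbed in the right factors. *)
Lemma simple_unit_sum e : simple_cstar A -> e <> 0 ->
  exists m (x y : nat -> A), \sum_(i < m) x i * e * y i = 1.
Proof.
move=> simp e0.
pose J : set A := [set s | exists l : seq (A * A), s = \sum_(c <- l) c.1 * e * c.2]%classic.
pose I : set A :=
  [set x | forall d : R, 0 < d -> exists2 b, J b & anorm (x - b) < d]%classic.
have JI b : J b -> I b by move=> Jb d d0; exists b => //; rewrite subrr anorm0.
have Je : J e by exists [:: (1, 1)]; rewrite big_seq1 /= mul1r mulr1.
have cI : closed_ideal I.
  split.
  - exact: norm_closed_closure.
  - by apply: JI; exists [::]; rewrite big_nil.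
  - move=> x y Ix Iy d d0.
    have [|b [l1 ->] h1] := Ix (d / 2); first lra.
    have [|c [l2 ->] h2] := Iy (d / 2); first lra.
    exists (\sum_(c <- l1 ++ l2) c.1 * e * c.2); first by exists (l1 ++ l2).
    rewrite big_cat opprD addrACA; apply: le_lt_trans (ler_anormD _ _) _; lra.
  - move=> a x Ix.
    have K0 : 0 < anorm a + 1 by rewrite ltr_wpDl ?anorm_ge0.
    split=> d d0; have [|b [l ->] hb] := Ix (d / (anorm a + 1)).
    - exact: divr_gt0.
    - exists (\sum_(c <- [seq (a * u.1, u.2) | u <- l]) c.1 * e * c.2).
        by exists [seq (a * u.1, u.2) | u <- l].
      rewrite big_map /=.
      have -> : \sum_(c <- l) a * c.1 * e * c.2 = a * \sum_(c <- l) c.1 * e * c.2.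
        by rewrite mulr_sumr; apply: eq_bigr => c _; rewrite !mulrA.
      rewrite -mulrBr; apply: le_lt_trans (ler_anormM _ _) _.
      move: hb; rewrite ltr_pdivlMr // mulrDr mulr1 mulrC.
      by apply: le_lt_trans; rewrite lerDl anorm_ge0.
    - exact: divr_gt0.
    - exists (\sum_(c <- [seq (u.1, u.2 * a) | u <- l]) c.1 * e * c.2).
        by exists [seq (u.1, u.2 * a) | u <- l].
      rewrite big_map /=.
      have -> : \sum_(c <- l) c.1 * e * (c.2 * a) = (\sum_(c <- l) c.1 * e * c.2) * a.
        by rewrite mulr_suml; apply: eq_bigr => c _; rewrite !mulrA.
      rewrite -mulrBl; apply: le_lt_trans (ler_anormM _ _) _.
      move: hb; rewrite ltr_pdivlMr // mulrDr mulr1.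
      by apply: le_lt_trans; rewrite lerDl anorm_ge0.
have I1 : I 1.
  have [IE|->] := simp I cI; last by [].
  by case: e0; have := JI _ Je; rewrite IE.
have [b [l ->]] := I1 1 ltr01.
move=> /invertible_near1 [y [sy _]].
exists (size l), (fun i => (nth (0, 0) l i).1), (fun i => (nth (0, 0) l i).2 * y).
rewrite -sy mulr_suml (big_nth (0, 0)) big_mkord.
by apply: eq_bigr => i _; rewrite mulrA.
Qed.

(** Let 1 be the sum of the x_i e y_i (i < m), e being the defect of an isometry V
    commuting with an infinite projection below p.  For each k, X_k is the sum
    of the V^(km+i) e y_i: blocks of m consecutive wandering subspaces are used,
    so that different X_k have orthogonal ranges below p, and star(X_k) X_k
    does not depend on k.  Since X_0 has the left inverse given by the sum of
    the x_i star(V^i e), the X_k can be normalized to isometries. *)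
Lemma orthogonal_isometries p : simple_cstar A -> purely_infinite A ->
  is_projection p -> p <> 0 -> exists w : nat -> A,
  (forall i j, star (w i) * w j = (i == j)%:R) /\ (forall i, p * w i = w i).
Proof.
move=> simp pinf pP p0.
have [|q [[pq qp] iq]] := pinf _ (corner_hereditary pP).
  move=> E; have : corner p p by case: pP.
  by rewrite E.
have [V [VV ne qV qe]] := infinite_projection_isometry iq.
pose e := 1 - V * star V.
have e0 : e <> 0 by move=> /eqP; rewrite subr_eq0 => /eqP/esym.
have [m [x [y xy]]] := simple_unit_sum simp e0.
pose b i := V ^+ i * e.
have bb i j : star (b i) * b j = e *+ (i == j) by exact: wandering_orthogonal.
have pb i : p * b i = b i.
  suff qb : q * b i = b i by rewrite -qb mulrA pq.
  have qVi : q * V ^+ i = V ^+ i * q by apply: commrX; exact: qV.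
  by rewrite /b mulrA qVi -mulrA qe.
clearbody b.
have m0 : (0 < m)%N.
  rewrite lt0n; apply: contraTneq isT => mz; move: xy; rewrite mz big_ord0.
  by move/eqP; rewrite eq_sym oner_eq0.
pose X (k : nat) := \sum_(i < m) b (k * m + i)%N * y i.
pose a := \sum_(i < m) star (y i) * e * y i.
have XX (k l : nat) : star (X k) * X l = a *+ (k == l).
  rewrite /X star_sum mulr_suml.
  have -> : a *+ (k == l) = \sum_(i < m) (star (y i) * e * y i) *+ (k == l).
    by rewrite /a -sumrMnl.
  apply: eq_bigr => i _; rewrite mulr_sumr (bigD1 i) //= big1 ?addr0.
    rewrite star_mul_mul bb eqn_add2r eqn_pmul2r //.
    by case: (k == l); rewrite ?mulr0n ?mulr1n ?mulr0 ?mul0r.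
  move=> j ji; rewrite star_mul_mul bb.
  rewrite (_ : (_ == _) = false) ?mulr0n ?mulr0 ?mul0r //.
  apply: contraNF ji => /eqP h; apply/eqP/val_inj => /=.
  have := congr1 (fun n => n %% m)%N h.
  by rewrite !modnMDl !modn_small.
have ZX : (\sum_(i < m) x i * star (b i)) * X 0%N = 1.
  rewrite -xy /X mulr_suml; apply: eq_bigr => i _.
  rewrite mulr_sumr (bigD1 i) //= big1 ?addr0.
    by rewrite mul0n add0n -mulrA (mulrA _ (b i)) bb eqxx mulr1n mulrA.
  move=> j ji; rewrite mul0n add0n -mulrA (mulrA _ (b j)) bb.
  rewrite (_ : (_ == _) = false) ?mulr0n ?mul0r ?mulr0 //.
  by rewrite eq_sym (inj_eq val_inj); exact: negbTE.
have [h [sh hah]] := left_invertible_normalization ZX.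
rewrite XX eqxx mulr1n in hah.
exists (fun k : nat => X k * h); split=> [k l|k].
  rewrite starM sh mulrA -(mulrA h) XX.
  by case: (k == l); rewrite ?mulr1n ?mulr0n ?hah // mulr0 mul0r.
rewrite mulrA; congr (_ * _); rewrite /X mulr_sumr.
by apply: eq_bigr => i _; rewrite mulrA pb.
Qed.
End PurelyInfinite.

(** * Roots of -1 and their moments *)

Section RootsOfMinusOne.
Variables (R : realType) (m : nat).
Hypothesis m3 : (2 < m)%N.

Lemma geometric_root_sum (F : fieldType) (x : F) n :
  x ^+ n = 1 -> x != 1 -> \sum_(j < n) x ^+ j = 0.
Proof.
move=> xn x1; have := subrX1 x n; rewrite xn subrr => /esym/eqP.
by rewrite mulf_eq0 subr_eq0 (negbTE x1) => /eqP.
Qed.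

Let th : R := pi / m%:R.
Definition zeta : R[i] := (cos th +i* sin th)%C.
Definition cos_step : R := cos th.
Definition radius : R := (2 * cos_step)^-1.
Definition node k : R[i] := zeta ^+ (2 * k + 1).
(** The squared coordinates of p; up to sign, the residues at radius * node k of
    z^(m-2) divided by the monic polynomial whose roots are the scaled nodes
    with nonzero weight. *)
Definition weight k : R := 2 * radius / m%:R * (cos_step - complex.Re (node k)).

Let m0 : (0 : R) < m%:R.
Proof. by rewrite ltr0n (leq_trans _ m3). Qed.

Let mth : m%:R * th = pi.
Proof. by rewrite /th mulrC divfK // gt_eqF. Qed.

Let th0 : 0 < th.
Proof. by rewrite divr_gt0 ?pi_gt0. Qed.

Lemma cos_step_gt0 : 0 < cos_step.
Proof.
apply: cos_gt0_pihalf; apply/andP; split.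
  by apply: lt_trans th0; rewrite oppr_lt0 divr_gt0 ?pi_gt0.
by rewrite ltr_pM2l ?pi_gt0 // ltf_pV2 ?posrE // ltr_nat.
Qed.

Lemma radius_gt0 : 0 < radius.
Proof. by rewrite invr_gt0 mulr_gt0 // cos_step_gt0. Qed.

Lemma radius_cos : 2 * radius * cos_step = 1.
Proof. by rewrite mulrAC mulfV // mulf_neq0 // gt_eqF // cos_step_gt0. Qed.

Lemma zetaX n : zeta ^+ n = (cos (n%:R * th) +i* sin (n%:R * th))%C.
Proof.
elim: n => [|n IH]; first by rewrite expr0 mul0r cos0 sin0.
rewrite exprS IH /zeta -addn1 natrD mulrDl mul1r cosD sinD.
apply/eqP; rewrite eq_complex /=; apply/andP; split; apply/eqP; ring.
Qed.

Lemma zetaXm : zeta ^+ m = -1.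
Proof.
by rewrite zetaX mth cospi sinpi; apply/eqP; rewrite eq_complex /= oppr0 !eqxx.
Qed.

Lemma zeta_neq0 : zeta != 0.
Proof.
apply: contraTneq isT => h; have := zetaXm; rewrite h expr0n.
case: m m3 => // n _ /= /eqP; rewrite eq_sym oppr_eq0 oner_eq0 //.
Qed.

Lemma node_neq0 k : node k != 0.
Proof. by rewrite expf_neq0 // zeta_neq0. Qed.

Lemma cabs_node k : cabs (node k) = 1.
Proof.
by rewrite /cabs normc_def /node zetaX /= cos2Dsin2 sqrtr1.
Qed.

Lemma nodeJ k : (node k)^* = (node k)^-1.
Proof.
apply: (mulIf (node_neq0 k)); rewrite mulVf ?node_neq0 // mulrC -normCK.
by rewrite -cabsE cabs_node expr1n.
Qed.

Lemma node_addV k : node k + (node k)^-1 = (2 * complex.Re (node k))%:C.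
Proof.
by rewrite -nodeJ /node zetaX /=; apply/eqP; rewrite eq_complex /= subrr mulrDl mul1r !eqxx.
Qed.

Lemma node_Xm k : node k ^+ m = -1.
Proof.
by rewrite /node exprAC zetaXm addn1 exprS exprM sqrrN !expr1n mulr1.
Qed.

Lemma zeta_double_neq1 j : (0 < j < m)%N -> zeta ^+ (2 * j) != 1.
Proof.
move=> /andP[j0 jm]; rewrite mulnC exprM -subr_eq0 subr_sqr_1.
have s0 : 0 < sin (j%:R * th).
  apply: sin_gt0_pi; rewrite mulr_gt0 ?ltr0n //= -mth ltr_pM2r // ltr_nat //.
rewrite mulf_eq0 negb_or zetaX; apply/andP; split.
  by rewrite subr_eq0 eq_complex /= (gt_eqF s0) andbF.
by rewrite addr_eq0 eq_complex /= oppr0 (gt_eqF s0) andbF.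
Qed.

(** The nodes are the m-th roots of -1, so their power sums of exponent
    0 < j < m vanish.  Via [weightE] this makes almost all weighted moments of
    the nodes vanish ([moment_eq0]). *)
Lemma node_sum j : (0 < j < m)%N -> \sum_(k < m) node k ^+ j = 0.
Proof.
move=> hj.
have -> : \sum_(k < m) node k ^+ j = zeta ^+ j * \sum_(k < m) (zeta ^+ (2 * j)) ^+ k.
  rewrite mulr_sumr; apply: eq_bigr => k _.
  by rewrite /node -!exprM -exprD; congr (_ ^+ _); lia.
rewrite geometric_root_sum ?mulr0 ?zeta_double_neq1 //.
by rewrite exprAC zetaXm exprM sqrrN !expr1n.
Qed.

Lemma node_inj (k l : 'I_m) : node k = node l -> k = l.
Proof.
wlog kl : k l / (k <= l)%N => [hw|].
  by case: (leqP k l) => [/hw //|/ltnW /hw h] /esym /h.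
move=> h; apply: contrapT => /eqP ne.
have lt : (k < l)%N by rewrite ltn_neqAle kl andbT.
have : zeta ^+ (2 * (l - k)) != 1.
  apply: zeta_double_neq1; rewrite subn_gt0 lt /=.
  by apply: leq_ltn_trans (leq_subr _ _) (ltn_ord l).
move/negP; apply; apply/eqP; apply: (mulfI (node_neq0 k)).
by rewrite mulr1 [RHS]h /node -exprD; congr (_ ^+ _); lia.
Qed.

Lemma node_orthogonal (k l : 'I_m) :
  \sum_(j < m) (node k / node l) ^+ j = (if k == l then m%:R else 0).
Proof.
case: eqVneq => [->|ne].
  rewrite mulfV ?node_neq0 // (eq_bigr (fun=> 1)) => [|i _]; last by rewrite expr1n.
  by rewrite sumr_const card_ord.
apply: geometric_root_sum.
  by rewrite expr_div_n !node_Xm mulfV // oppr_eq0 oner_eq0.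
apply: contraNneq ne => h; apply/eqP/node_inj.
by apply: (mulIf (invr_neq0 (node_neq0 l))); rewrite h mulfV ?node_neq0.
Qed.

Lemma weight_ge0 (k : 'I_m) : 0 <= weight k.
Proof.
apply: mulr_ge0; first by rewrite divr_ge0 ?mulr_ge0 // ltW // radius_gt0.
rewrite subr_ge0 /node zetaX /cos_step /=.
have le_cos x : th <= x <= pi -> cos x <= cos th.
  move=> /andP[x1 x2]; rewrite leNgt ltr_cos ?in_itv /= -?leNgt //.
    by rewrite (le_trans (ltW th0)).
  by rewrite (ltW th0) (le_trans x1).
set x := _ * th.
have x1 : th <= x.
  by rewrite /x ler_peMl ?(ltW th0) // ler1n addn1.
have x2 : x <= 2 * pi - th.
  have -> : 2 * pi - th = (2 * m%:R - 1) * th by rewrite -mth; ring.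
  rewrite /x ler_pM2r // natrD natrM.
  have : k.+1%:R <= m%:R :> R by rewrite ler_nat.
  rewrite -addn1 natrD; lra.
have [xp|xp] := leP x pi; first by apply: le_cos; rewrite x1.
have -> : cos x = cos (pi *+ 2 - x).
  by rewrite -cosN -cosD2pi addrC.
apply: le_cos; rewrite mulr2n; apply/andP; split; lra.
Qed.

Lemma weightE k : (weight k)%:C =
  (radius / m%:R)%:C * ((2 * cos_step)%:C - (node k + (node k)^-1)).
Proof.
rewrite node_addV -rmorphB -rmorphM /weight; congr (_%:C).
by ring.
Qed.

Lemma weight_neq0 k : weight k != 0 ->
  node k ^+ 2 - (2 * cos_step)%:C * node k + 1 != 0.
Proof.
apply: contraNneq => h.
have : (weight k)%:C = 0.
  rewrite weightE; apply/eqP; rewrite mulf_eq0; apply/orP; right.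
  rewrite subr_eq0; apply/eqP; apply: (mulIf (node_neq0 k)).
  rewrite [in RHS]mulrDl mulVf ?node_neq0 // -expr2; apply/eqP.
  by rewrite eq_sym -subr_eq0 addrAC h.
by move=> /eqP; rewrite fmorph_eq0.
Qed.

Let moment j := \sum_(k < m) (weight k)%:C * (radius%:C * node k) ^+ j.

Let momentE j : moment j.+1 = (radius / m%:R)%:C * radius%:C ^+ j.+1 *
  ((2 * cos_step)%:C * (\sum_(k < m) node k ^+ j.+1) -
   \sum_(k < m) node k ^+ j.+2 - \sum_(k < m) node k ^+ j).
Proof.
rewrite /moment mulr_sumr -!sumrB mulr_sumr; apply: eq_bigr => k _.
rewrite weightE exprMn !exprS; move: (node_neq0 k); move: (node k) => z n0.
move: (z ^+ j) (_ ^+ j) (_ / _)%:C => u v w; field.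
exact: n0.
Qed.

Lemma moment0 : \sum_(k < m) (weight k)%:C = 1.
Proof.
have sumV : \sum_(k < m) (node k)^-1 = 0.
  rewrite (eq_bigr (fun k : 'I_m => - node k ^+ m.-1)) => [|k _].
    rewrite sumrN node_sum ?oppr0 //; apply/andP; split; lia.
  apply: (mulfI (node_neq0 k)); rewrite mulfV ?node_neq0 // mulrN -exprS.
  by rewrite prednK ?node_Xm ?opprK //; lia.
rewrite (eq_bigr (fun k : 'I_m => (radius / m%:R)%:C * (2 * cos_step)%:C
  - (radius / m%:R)%:C * (node k + (node k)^-1))) => [|k _]; last first.
  by rewrite weightE mulrBr.
rewrite sumrB sumr_const card_ord -mulr_sumr big_split /= sumV.
have := @node_sum 1; rewrite (eq_bigr (fun k : 'I_m => node k)) // => -> //.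
  rewrite addr0 mulr0 subr0 -rmorphM -rmorphMn /=.
  rewrite (_ : _ *+ m = 1) ?rmorph1 //.
  transitivity (2 * radius * cos_step); last exact: radius_cos.
  by rewrite -mulr_natr; field; exact: lt0r_neq0.
by lia.
Qed.

Lemma moment1 : \sum_(k < m) (weight k)%:C * (radius%:C * node k) = - (radius ^+ 2)%:C.
Proof.
have := momentE 0; rewrite /moment (eq_bigr (fun k : 'I_m => (weight k)%:C * (radius%:C * node k))) // => ->.
rewrite (@node_sum 1) ?(@node_sum 2); try lia.
rewrite mulr0 subr0 sub0r (eq_bigr (fun=> 1)) // sumr_const card_ord expr1.
rewrite mulrN -(rmorph_nat (real_complex R) m) -!rmorphM -!rmorphN /=.
by congr (_%:C); field; exact: lt0r_neq0.
Qed.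

Lemma moment_eq0 j : (1 < j)%N -> (j.+1 < m)%N ->
  \sum_(k < m) (weight k)%:C * (radius%:C * node k) ^+ j = 0.
Proof.
case: j => // j j1 jm; have := momentE j; rewrite /moment => ->.
by rewrite !node_sum ?mulr0 ?subrr ?mulr0 //; lia.
Qed.

Let al := radius%:C * zeta.
Let be := radius%:C * zeta^-1.

Let al_neq0 : al != 0.
Proof. by rewrite mulf_neq0 ?zeta_neq0 // fmorph_eq0 gt_eqF // radius_gt0. Qed.
Let be_neq0 : be != 0.
Proof. by rewrite mulf_neq0 ?invr_eq0 ?zeta_neq0 // fmorph_eq0 gt_eqF // radius_gt0. Qed.

Let al_sub_be : al - be != 0.
Proof.
rewrite -mulrBr mulf_neq0 //; first by rewrite fmorph_eq0 gt_eqF // radius_gt0.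
apply: contraTneq (@zeta_double_neq1 1 _) => [h|]; last by lia.
rewrite negbK muln1 expr2; move/eqP: h; rewrite subr_eq0 => /eqP {1}->.
by rewrite mulVf // zeta_neq0.
Qed.

Let al_add_be : al + be = 1.
Proof.
rewrite -mulrDr; have := node_addV 0; rewrite /node muln0 add0n expr1 => ->.
by rewrite -rmorphM /= /zeta /= -/cos_step mulrA [radius * 2]mulrC radius_cos.
Qed.

Let al_mul_be : al * be = (radius ^+ 2)%:C.
Proof.
by rewrite /al /be mulrACA mulfV ?zeta_neq0 // mulr1 -rmorphM expr2.
Qed.

(** The coefficients of the power series 1 / (1 - t + radius^2 t^2), whose
    denominator factors as (1 - al t) (1 - be t); up to powers of the radius
    they are the values at [cos_step] of the Chebyshev polynomials of the second
    kind. *)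
Definition quotient_coef i : R[i] := (al ^+ i.+1 - be ^+ i.+1) / (al - be).

Lemma quotient_coef0 : quotient_coef 0 = 1.
Proof. by rewrite /quotient_coef !expr1 mulfV. Qed.

Lemma quotient_coef1 : quotient_coef 1 = 1.
Proof. by rewrite /quotient_coef subr_sqr mulrAC mulfV // mul1r. Qed.

Lemma quotient_coef_rec i : quotient_coef i.+2 = quotient_coef i.+1 - (radius ^+ 2)%:C * quotient_coef i.
Proof.
rewrite /quotient_coef -al_mul_be -[al ^+ i.+2 - _]mul1r -al_add_be !exprS.
by field.
Qed.

Lemma quotient_coef_last : quotient_coef m.-1 = 0.
Proof.
rewrite /quotient_coef prednK; last by lia.
by rewrite !exprMn exprVn zetaXm invrN1 subrr mul0r.
Qed.

Lemma quotient_coef_penultimate : (radius ^+ 2)%:C * quotient_coef m.-2 = radius%:C ^+ m.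
Proof.
have m2 : m.-2.+1 = m.-1 by lia.
have e (x : R[i]) : x != 0 -> x ^+ m.-1 = x ^+ m / x.
  by move=> x0; apply: (mulIf x0); rewrite divfK // -exprSr prednK //; lia.
have alm : al ^+ m = - radius%:C ^+ m by rewrite exprMn zetaXm mulrN1.
have bem : be ^+ m = - radius%:C ^+ m by rewrite exprMn exprVn zetaXm invrN1 mulrN1.
rewrite /quotient_coef m2 !e // -al_mul_be alm bem.
move: (radius%:C ^+ m) al be al_neq0 be_neq0 al_sub_be => u x y x0 y0 xy.
by field; rewrite x0 y0 xy.
Qed.

(** Horner values for the coefficients [quotient_coef]; the one of index m - 2 is
    the quotient of z^m + radius^m by z^2 - z + radius^2, so it vanishes at the
    scaled nodes with nonzero weight. *)
Fixpoint horner_quotient k (z : R[i]) : R[i] :=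
  if k is k'.+1 then z * horner_quotient k' z + quotient_coef k else 1.

Lemma horner_quotient_sum k z : horner_quotient k z = \sum_(i < k.+1) quotient_coef i * z ^+ (k - i).
Proof.
elim: k => [|k IH]; first by rewrite big_ord_recr big_ord0 /= quotient_coef0 add0r mulr1.
rewrite big_ord_recr /= subnn mulr1 IH mulr_sumr; congr (_ + _).
by apply: eq_bigr => i _; rewrite mulrCA -exprS subSn // -ltnS.
Qed.

Lemma horner_quotient_mul_quad k z : (z ^+ 2 - z + (radius ^+ 2)%:C) * horner_quotient k z =
  z ^+ k.+2 - quotient_coef k.+1 * z + (radius ^+ 2)%:C * quotient_coef k.
Proof.
elim: k => [|k IH]; first by rewrite quotient_coef0 quotient_coef1 !mulr1 mul1r.
rewrite [horner_quotient _ _]/= mulrDr mulrCA IH quotient_coef_rec !exprS; ring.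
Qed.

Lemma horner_quotient_node (k : 'I_m) : weight k != 0 -> horner_quotient m.-2 (radius%:C * node k) = 0.
Proof.
move=> /weight_neq0 wk; have := horner_quotient_mul_quad m.-2 (radius%:C * node k).
have e2 : m.-2.+2 = m by lia.
have e1 : m.-2.+1 = m.-1 by lia.
rewrite e2 e1 quotient_coef_last quotient_coef_penultimate mul0r subr0 [_ ^+ m]exprMn node_Xm mulrN1 addNr => /eqP.
rewrite mulf_eq0 => /orP[|/eqP //] /eqP h; case/negP: wk; apply/eqP.
have r0 : radius%:C ^+ 2 != 0 :> R[i] by rewrite expf_neq0 // fmorph_eq0 gt_eqF // radius_gt0.
apply: (mulfI r0); rewrite mulr0 -[RHS]h mulrDr mulrBr -exprMn mulr1 rmorphXn.
congr (_ - _ + _); rewrite mulrA expr2 -!rmorphM; congr (_%:C * _).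
by transitivity (radius * (2 * radius * cos_step)); [ring|rewrite radius_cos mulr1].
Qed.

(** Only the moments of order 0 and 1 contribute, and they reproduce the
    recurrence of the coefficients.  This is what makes N act on these
    polynomials as a shift. *)
Lemma horner_quotient_moment k : (k.+2 < m)%N ->
  \sum_(l < m) (weight l)%:C * horner_quotient k (radius%:C * node l) = quotient_coef k.+1.
Proof.
move=> km.
under eq_bigr do rewrite horner_quotient_sum mulr_sumr.
rewrite exchange_big /=.
have -> : \sum_(i < k.+1) \sum_(l < m) (weight l)%:C * (quotient_coef i * (radius%:C * node l) ^+ (k - i))
  = \sum_(i < k.+1) quotient_coef i * moment (k - i).
  by apply: eq_bigr => i _; rewrite /moment mulr_sumr; apply: eq_bigr => l _; rewrite mulrCA.
have mom0 : moment 0 = 1.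
  by rewrite -moment0; apply: eq_bigr => l _; rewrite mulr1.
case: k km => [|k] km.
  by rewrite big_ord_recr big_ord0 /= mom0 quotient_coef0 quotient_coef1 add0r mulr1.
rewrite !big_ord_recr /= subnn mom0 subSnn big1 => [|i _]; last first.
  rewrite /moment moment_eq0 ?mulr0 //; have := ltn_ord i; lia.
have -> : moment 1 = - (radius ^+ 2)%:C.
  by rewrite -moment1; apply: eq_bigr => l _; rewrite expr1.
by rewrite quotient_coef_rec mulr1 mulrN add0r addrC mulrC.
Qed.

End RootsOfMinusOne.

(** The cosine of pi / m tends to 1. *)
Lemma radius_near_half (R : realType) (e : R) : 0 < e ->
  exists2 m, (2 < m)%N & radius R m < 1 / 2 + e.
Proof.
move=> e0.
have d0 : 0 < 1 - (1 + 2 * e)^-1 :> R.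
  by rewrite subr_gt0 invf_lt1; lra.
have /cvgrPdist_lt /(_ _ d0) := @continuous_cos R 0.
move=> /nbhs_ballP [d /= dp hd].
exists (maxn 3 (Num.truncn (pi / d)).+1); first by rewrite leq_max.
set m := maxn _ _.
have m0 : (0 : R) < m%:R by rewrite ltr0n leq_max.
have hm : pi / m%:R < d.
  rewrite ltr_pdivrMr // mulrC -ltr_pdivrMr //.
  by apply: lt_le_trans (truncnS_gt _) _; rewrite ler_nat leq_maxr.
have p0 : 0 < pi / m%:R :> R by rewrite divr_gt0 ?pi_gt0.
have := hd (pi / m%:R); rewrite cos0 /ball /= sub0r normrN gtr0_norm // => /(_ hm).
rewrite ger0_norm ?subr_ge0 ?cos_le1 // => hc.
have hc2 : (1 + 2 * e)^-1 < cos_step R m by rewrite /cos_step; lra.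
have i0 : 0 < (1 + 2 * e)^-1 by rewrite invr_gt0; lra.
have -> : 1 / 2 + e = (2 * (1 + 2 * e)^-1)^-1 by rewrite invfM invrK; lra.
by rewrite /radius ltf_pV2 ?posrE ?mulr_gt0 //; [rewrite ltr_pM2l|exact: lt_trans hc2].
Qed.

(** * Nilpotents near a projection *)

Section NilpotentApproximation.
Variables (R : realType) (A : cstarAlgType R) (m : nat) (p : A) (v : nat -> A).
Hypothesis m3 : (2 < m)%N.
Hypothesis pP : is_projection p.
Hypothesis vv : forall i j, star (v i) * v j = (i == j)%:R.
Hypothesis pv : forall i, p * v i = 0.

Local Notation r := (radius R m).
Local Notation wt := (weight R m).
Local Notation nd := (node R m).

Let sp : star p = p. Proof. by case: pP. Qed.
Let pp : p * p = p. Proof. by case: pP. Qed.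

Let xi (k : 'I_m) : R := Num.sqrt (wt k).

Let xi_sqr k : xi k * xi k = wt k.
Proof. by rewrite -expr2 sqr_sqrtr // weight_ge0. Qed.

(** The v_k span copies of p below 1 - p; removing from v_k its component along
    V and adding xi_k p gives an orthonormal system in which p has the
    coordinates xi_k. *)
Let V : A := \sum_(k < m) (xi k)%:C *: v k.
Let u (k : 'I_m) : A := v k - (xi k)%:C *: V.
Let w (k : 'I_m) : A := (xi k)%:C *: p + u k * p.

Let vV (i : 'I_m) : star (v i) * V = (xi i)%:C%:A.
Proof.
rewrite /V mulr_sumr (bigD1 i) //= big1 ?addr0.
  by rewrite -scalerAr vv eqxx.
move=> j ji; rewrite -scalerAr vv (inj_eq val_inj) eq_sym (negbTE ji).
by rewrite scaler0.
Qed.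

Let Vv (j : 'I_m) : star V * v j = (xi j)%:C%:A.
Proof. by rewrite -[LHS]starK starM starK vV star_alg. Qed.

Let VV : star V * V = 1.
Proof.
rewrite {2}/V mulr_sumr.
rewrite (eq_bigr (fun k : 'I_m => (wt k)%:C%:A)) => [|k _].
  by rewrite -scaler_suml moment0 // scale1r.
by rewrite -scalerAr Vv scalerA -rmorphM /= xi_sqr.
Qed.

Let uu i j : star (u i) * u j = ((i == j)%:R - (xi i * xi j)%:C)%:A.
Proof.
rewrite /u starB starZr mulrBl !mulrBr -!scalerAl -!scalerAr vv vV Vv VV !scalerA.
rewrite (inj_eq val_inj) -!rmorphM /= [xi j * xi i]mulrC subrr subr0 scalerBl.
by case: (i == j); rewrite ?scale1r ?scale0r.
Qed.

Let pu k : p * u k = 0.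
Proof.
rewrite /u mulrBr pv -scalerAr /V mulr_sumr big1 ?scaler0 ?subrr // => i _.
by rewrite -scalerAr pv scaler0.
Qed.

Let ww i j : star (w i) * w j = p *+ (i == j).
Proof.
have up k : star (u k) * p = 0 by rewrite -{1}sp -starM pu star0.
rewrite /w starD starZr starM sp mulrDl !mulrDr -!scalerAl -!scalerAr pp.
rewrite (mulrA p (u j)) pu mul0r scaler0 addr0 -(mulrA p _ p) up mulr0 scaler0 add0r.
rewrite -(mulrA p) (mulrA (star _)) uu -scalerAl mul1r -scalerAr pp scalerA -rmorphM.
by rewrite -scalerDl addrC subrK; case: (i == j); rewrite ?scale1r ?scale0r.
Qed.

Let pw k : p * w k = (xi k)%:C *: p.
Proof. by rewrite /w mulrDr -scalerAr pp mulrA pu mul0r addr0. Qed.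

Let wp k : w k * p = w k.
Proof. by rewrite /w mulrDl -scalerAl -mulrA pp. Qed.

Let sum_w : \sum_(k < m) (xi k)%:C *: w k = p.
Proof.
have -> : \sum_(k < m) (xi k)%:C *: w k =
    \sum_(k < m) (wt k)%:C *: p + (\sum_(k < m) (xi k)%:C *: u k) * p.
  rewrite mulr_suml -big_split; apply: eq_bigr => k _ /=.
  by rewrite scalerDr scalerA -rmorphM /= xi_sqr scalerAl.
rewrite -scaler_suml moment0 // scale1r.
suff -> : \sum_(k < m) (xi k)%:C *: u k = 0 by rewrite mul0r addr0.
rewrite /u (eq_bigr (fun k : 'I_m => (xi k)%:C *: v k - (wt k)%:C *: V)) => [|k _].
  by rewrite sumrB -scaler_suml moment0 // scale1r subrr.
by rewrite scalerBr scalerA -rmorphM /= xi_sqr.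
Qed.

Let b (k : 'I_m) : R[i] := if wt k == 0 then 0 else r%:C * nd k.
Let D : A := \sum_(k < m) b k *: (w k * star (w k)).
Let N : A := p + D.

Let Dw k : D * w k = b k *: w k.
Proof.
rewrite /D mulr_suml (bigD1 k) //= big1 ?addr0 => [|j jk].
  by rewrite -scalerAl -mulrA ww eqxx mulr1n wp.
by rewrite -scalerAl -mulrA ww (negbTE jk) mulr0n mulr0 scaler0.
Qed.

(** D is the radius times a partial isometry: star(D) D is the squared radius
    times the projection onto the span of the w_k with nonzero weight. *)
Lemma anorm_perturbation : anorm D <= r.
Proof.
have r0 := ltW (radius_gt0 R m3).
pose Q := \sum_(k < m) (wt k != 0)%:R *: (w k * star (w k)).
have Qw k : Q * w k = (wt k != 0)%:R *: w k.
  rewrite /Q mulr_suml (bigD1 k) //= big1 ?addr0 => [|j jk].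
    by rewrite -scalerAl -mulrA ww eqxx mulr1n wp.
  by rewrite -scalerAl -mulrA ww (negbTE jk) mulr0n mulr0 scaler0.
have QQ : Q * Q = Q.
  rewrite {2}/Q mulr_sumr; apply: eq_bigr => k _.
  rewrite -scalerAr mulrA Qw -scalerAl scalerA.
  by case: (wt k != 0); rewrite ?mulr1 ?mulr0.
have sQ : star Q = Q.
  rewrite /Q star_sum; apply: eq_bigr => k _.
  by rewrite starZ starM starK; case: (wt k != 0); rewrite ?conjC1 ?conjC0.
have DD : star D * D = (r ^+ 2)%:C *: Q.
  rewrite {2}/D mulr_sumr /Q scaler_sumr; apply: eq_bigr => k _.
  have -> : star D * (b k *: (w k * star (w k))) = b k *: (star D * w k) * star (w k).
    by rewrite -scalerAr -scalerAl mulrA.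
  have -> : star D * w k = (b k)^* *: w k.
    rewrite /D star_sum mulr_suml (bigD1 k) //= big1 ?addr0 => [|j jk].
      by rewrite starZ starM starK -scalerAl -mulrA ww eqxx mulr1n wp.
    by rewrite starZ starM starK -scalerAl -mulrA ww (negbTE jk) mulr0n mulr0 scaler0.
  rewrite scalerA -!scalerAl scalerA; congr (_ *: _).
  rewrite /b; case: eqVneq => _; first by rewrite mul0r mulr0.
  by rewrite mulr1 -normCK -cabsE cabsM cabs_node cabsR mulr1 ger0_norm // rmorphXn.
rewrite -(ler_sqr (anorm_ge0 _) r0) -cstar_identity DD anormZr ger0_norm ?sqr_ge0 //.
by rewrite ler_piMr ?sqr_ge0 // projection_anorm.
Qed.

(** Vectors in the cyclic space of p, written as functions on the nodes: D
    multiplies by b, and p integrates against the weights. *)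
Let G (g : 'I_m -> R[i]) : A := \sum_(k < m) ((xi k)%:C * g k) *: w k.

Let NG g : N * G g =
  G (fun k => b k * g k) + (\sum_(k < m) (wt k)%:C * g k) *: p.
Proof.
rewrite /N mulrDl addrC; congr (_ + _).
  rewrite /G mulr_sumr; apply: eq_bigr => k _.
  by rewrite -scalerAr Dw scalerA mulrAC mulrA.
rewrite /G mulr_sumr scaler_suml; apply: eq_bigr => k _.
by rewrite -scalerAr pw scalerA -xi_sqr rmorphM mulrAC.
Qed.

Let bE (k : 'I_m) : wt k != 0 -> b k = r%:C * nd k.
Proof. by rewrite /b => /negbTE ->. Qed.

Let pG : p = G (fun=> 1).
Proof. by rewrite -{1}sum_w; apply: eq_bigr => k _; rewrite mulr1. Qed.

(** N multiplies by z and adds the moment, which is the next Horner step. *)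
Let N_pow_p k : (k.+1 < m)%N -> N ^+ k * p = G (fun l => horner_quotient m k (r%:C * nd l)).
Proof.
elim: k => [|k IH] km; first by rewrite mul1r {1}pG.
rewrite exprS -mulrA IH; last by lia.
rewrite NG horner_quotient_moment // {1}pG.
have -> (c : R[i]) : c *: G (fun=> 1) = G (fun=> c).
  by rewrite /G scaler_sumr; apply: eq_bigr => l _; rewrite scalerA mulr1 mulrC.
rewrite /G -big_split; apply: eq_bigr => l _ /=.
rewrite -scalerDl -mulrDr; congr (_ *: _).
have [w0|/bE -> //] := eqVneq (wt l) 0.
by rewrite /xi w0 sqrtr0 !mul0r.
Qed.

Let n := m.-2.

Let Nn_p : N ^+ n * p = 0.
Proof.
rewrite N_pow_p; last by rewrite /n; lia.
rewrite /G big1 // => k _; have [w0|/horner_quotient_node ->] := eqVneq (wt k) 0 => //.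
  by rewrite /xi w0 sqrtr0 mul0r scale0r.
by rewrite mulr0 scale0r.
Qed.

(** N G(b^j) differs from G(b^(j+1)) by a multiple of p, and N^n p = 0. *)
Let Nn_G j : N ^+ n * G (fun k => b k ^+ j) = 0.
Proof.
elim: j => [|j IH]; first by rewrite -pG Nn_p.
have := NG (fun k => b k ^+ j).
have -> : G (fun k => b k * b k ^+ j) = G (fun k => b k ^+ j.+1).
  by apply: eq_bigr => k _; rewrite exprS.
move=> /eqP; rewrite -subr_eq => /eqP <-.
by rewrite mulrBr mulrA -exprSr exprS -mulrA IH mulr0 -scalerAr Nn_p scaler0 subrr.
Qed.

(** Fourier inversion over the nodes recovers each w_l from the G(b^j). *)
Let Nn_w (l : 'I_m) : wt l != 0 -> N ^+ n * w l = 0.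
Proof.
move=> wl; pose t (k : 'I_m) := (xi k)%:C *: (N ^+ n * w k).
have r0 : r%:C != 0 :> R[i] by rewrite fmorph_eq0 gt_eqF // radius_gt0.
have t_sum j : \sum_(k < m) nd k ^+ j *: t k = 0.
  apply: (scalerI (expf_neq0 j r0)); rewrite scaler0 -[RHS](Nn_G j) /G mulr_sumr scaler_sumr.
  apply: eq_bigr => k _; rewrite /t -scalerAr !scalerA.
  have [w0|/bE ->] := eqVneq (wt k) 0.
    by rewrite /xi w0 sqrtr0 !(mulr0, mul0r, scale0r).
  by rewrite exprMn; congr (_ *: _); ring.
have tl : m%:R *: t l = 0.
  have -> : m%:R *: t l = \sum_(j < m) (nd l)^-1 ^+ j *: (\sum_(k < m) nd k ^+ j *: t k).
    under eq_bigr do rewrite scaler_sumr.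
    rewrite exchange_big /= (bigD1 l) //= [X in _ + X]big1 ?addr0 => [|k kl].
      under eq_bigr do rewrite scalerA -exprMn mulrC.
      by rewrite -scaler_suml node_orthogonal // eqxx.
    under eq_bigr do rewrite scalerA -exprMn mulrC.
    by rewrite -scaler_suml node_orthogonal // (negbTE kl) scale0r.
  by rewrite big1 // => j _; rewrite t_sum scaler0.
have m0 : m%:R != 0 :> R[i] by rewrite pnatr_eq0; lia.
have xl : (xi l)%:C != 0 :> R[i].
  by rewrite fmorph_eq0 sqrtr_eq0 -ltNge lt_def wl weight_ge0.
by move/eqP: tl; rewrite !scaler_eq0 (negbTE m0) (negbTE xl) => /eqP.
Qed.

(** It remains to see that N^(m-2) kills p and every w_k that occurs in D, for
    then it kills N = p + D. *)
Lemma nilpotent_near_projection : exists2 q, nilpotents A q & anorm (p - q) <= r.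
Proof.
exists N; last by rewrite /N opprD addrA subrr sub0r anormN anorm_perturbation.
exists n.+1; rewrite exprSr {2}/N mulrDr Nn_p add0r /D mulr_sumr big1 // => k _.
rewrite -scalerAr mulrA; have [w0|/Nn_w ->] := eqVneq (wt k) 0.
  by rewrite /b w0 eqxx scale0r.
by rewrite mul0r scaler0.
Qed.
End NilpotentApproximation.

Theorem theorem2p13 (R : realType) (A : cstarAlgType R)
    (hsimple : simple_cstar A) (hpi : purely_infinite A)
    (P : A) (hP : is_projection P) :
  [/\ (P = 0 -> dist_to P (nilpotents A) = 0 /\ dist_to P (quasinilpotents A) = 0),
      (P = 1 -> dist_to P (nilpotents A) = 1 /\ dist_to P (quasinilpotents A) = 1)
    & (P <> 0 -> P <> 1 ->
       dist_to P (nilpotents A) = 1 / 2 /\ dist_to P (quasinilpotents A) = 1 / 2)].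
Proof.
have nil0 : nilpotents A 0 by exists 1%N; rewrite expr1.
split=> [->|->|P0 P1]; apply: dist_nilpotentsE.
- by move=> q _; exact: anorm_ge0.
- by move=> e e0; exists 0 => //; rewrite subr0 anorm0 add0r.
- exact: quasinil_anorm1_ge.
- by move=> e e0; exists 0 => //; rewrite subr0 anorm1 ltrDl.
- by move=> q; exact: quasinil_anorm_ge.
move=> e e0; have [m m3 hm] := radius_near_half e0.
have P1' : 1 - P <> 0 by move=> /eqP; rewrite subr_eq0 => /eqP/esym.
have [v [vv pv]] := orthogonal_isometries hsimple hpi (projection_compl hP) P1'.
have Pv i : P * v i = 0.
  by rewrite -(pv i) mulrA mulrBr mulr1 hP.2 subrr mul0r.
have [q nq hq] := nilpotent_near_projection m3 hP vv Pv.
by exists q => //; apply: le_lt_trans hq hm.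
Qed.
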